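(* Let $n\ge 1$, $R>0$, $p>1$, and let $B_R\subset\mathbb{R}^n$ be the ball of radius $R$ centered at the origin. Let $u_0:\overline{B}_R\to\mathbb{R}$ be smooth, not identically zero, nonnegative, radially symmetric, nonincreasing as a function of $r=|x|$, vanishing on $\partial B_R$, and such that $$\Delta u_0(x)+e^{u_0(x)^p}\ge 0,\qquad x\in B_R .$$ Let $u$ be a classical solution of $$u_t=\Delta u+e^{u^p}\ \text{ in } B_R\times(0,T),\qquad u=0\ \text{ on } \partial B_R\times(0,T),\qquad u(x,0)=u_0(x)\ \text{ for } x\in B_R,$$ which blows up at the finite time $T$. Suppose in addition that there is $\delta>0$ such that $$u_{0r}(r)\le -\delta r\qquad\text{for } 0<r\le R .$$ Then $x=0$ is the only blow-up point of $u$.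
   Context: Radial functions are written as functions of $r=|x|$, so $u_0(r)=u_0(x)$, and $u_{0r}$ denotes the derivative of $u_0$ with respect to $r$. A (nonnegative) classical solution is one that is continuous on $\overline{B}_R\times[0,T)$, is $C^{2}$ in $x$ and $C^1$ in $t$ for $0<t<T$, and satisfies the problem pointwise. The solution blows up at the finite time $T$ (i.e. $u$ is a blow-up solution with blow-up time $T$) if it is a classical solution on $[0,T)$, $0<T<\infty$, and $\max_{\overline{B}_R}u(\cdot,t)\to\infty$ as $t\to T^-$. A point $x_0\in\overline{B}_R$ is a blow-up point if there are sequences $x_k\in \overline{B}_R$, $t_k\in(0,T)$ with $x_k\to x_0$, $t_k\to T$ and $u(x_k,t_k)\to\infty$. *)

(* Defs.v *)
From mathcomp Require Import all_boot all_order all_algebra.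
From mathcomp Require Import all_classical all_reals all_analysis.
Set Implicit Arguments.
Unset Strict Implicit.
Unset Printing Implicit Defensive.
Import Order.TTheory GRing.Theory Num.Theory.
Import numFieldNormedType.Exports.
Local Open Scope classical_set_scope.
Local Open Scope ring_scope.

Section Defs.
Variable R : realType.

Section Space.
Variable n : nat.
Implicit Types (x y : 'rV[R]_n) (f g : 'rV[R]_n -> R) (A U : set 'rV[R]_n).

(* The library norm on 'rV[R]_n is the sup norm, so that balls have to be
   defined from the Euclidean norm; the topologies coincide. *)
Definition enorm x : R := Num.sqrt (\sum_(i < n) x ord0 i ^+ 2).

Definition eball (r : R) : set 'rV[R]_n := [set x | enorm x < r].
Definition ecball (r : R) : set 'rV[R]_n := [set x | enorm x <= r].
Definition esphere (r : R) : set 'rV[R]_n := [set x | enorm x = r].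

Definition basis_vec (i : 'I_n) : 'rV[R]_n := delta_mx ord0 i.

Definition partial (i : 'I_n) f : 'rV[R]_n -> R := 'D_(basis_vec i) f.

Definition partials (s : seq 'I_n) f : 'rV[R]_n -> R := foldr partial f s.

Definition laplacian f x : R := \sum_(i < n) partial i (partial i f) x.

(* [f] is of class C^k on [U], for [U] open. *)
Definition Ck_on (k : nat) U f : Prop :=
  forall s : seq 'I_n, (size s <= k)%N -> forall x, U x ->
    {for x, continuous (partials s f)} /\
    ((size s < k)%N -> forall i, derivable (partials s f) x (basis_vec i)).

(* [f] is smooth on [A]: it extends to a C^oo function on an open
   neighbourhood of [A]. *)
Definition smooth_on A f : Prop :=
  exists U g, [/\ open U, A `<=` U, (forall x, A x -> g x = f x)
                & forall k, Ck_on k U g].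

End Space.

(* The derivative of [f] at [r] relative to [D]; one-sided at an endpoint of
   an interval [D]. *)
Definition derive_within (D : set R) (f : R -> R) (r : R) : R :=
  lim ((fun s => (f s - f r) / (s - r)) @ within D r^').

(* [u x t] is only meaningful for [x] in the closed ball of radius [rad] and
   [0 <= t < T].  The derivatives are required in the open ball only. *)
Record classical_solution (n : nat) (rad p T : R) (u0 : 'rV[R]_n -> R)
    (u : 'rV[R]_n -> R -> R) : Prop := ClassicalSolution {
  cs_nonneg : forall (x : 'rV[R]_n) (t : R), ecball rad x -> 0 <= t < T -> 0 <= u x t ;
  cs_continuous : {within ecball rad `*` `[0, T[,
                     continuous (fun z : 'rV[R]_n * R => u z.1 z.2)} ;
  cs_C2 : forall (t : R), 0 < t < T -> Ck_on 2 (eball rad) (u ^~ t) ;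
  cs_C1 : forall (x : 'rV[R]_n) (t : R), eball rad x -> 0 < t < T ->
    derivable (u x) t 1 /\ {for t, continuous (derive1 (u x))} ;
  cs_pde : forall (x : 'rV[R]_n) (t : R), eball rad x -> 0 < t < T ->
    derive1 (u x) t = laplacian (u ^~ t) x + expR (u x t `^ p) ;
  cs_boundary : forall (x : 'rV[R]_n) (t : R), esphere rad x -> 0 < t < T -> u x t = 0 ;
  cs_initial : forall x, eball rad x -> u x 0 = u0 x
}.

Definition blows_up_at (n : nat) (rad T : R) (u : 'rV[R]_n -> R -> R) : Prop :=
  sup [set u x t | x in ecball rad] @[t --> T^'-] --> +oo.

Definition blowup_point (n : nat) (rad T : R) (u : 'rV[R]_n -> R -> R)
    (x0 : 'rV[R]_n) : Prop :=
  ecball rad x0 /\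
  exists (x_ : nat -> 'rV[R]_n) (t_ : nat -> R),
    [/\ forall k, ecball rad (x_ k) /\ 0 < t_ k < T,
        x_ k @[k --> \oo] --> x0,
        t_ k @[k --> \oo] --> T
      & u (x_ k) (t_ k) @[k --> \oo] --> +oo].

End Defs.

(* Main.v *)
Require Import Defs.
From mathcomp Require Import all_boot all_order all_algebra.
From mathcomp Require Import all_classical all_reals all_analysis.
From mathcomp Require Import ring lra.
Import Order.TTheory GRing.Theory Num.Theory.
Import numFieldNormedType.Exports.
Local Open Scope classical_set_scope.
Local Open Scope ring_scope.

Set Implicit Arguments.
Unset Strict Implicit.
Unset Printing Implicit Defensive.

(** Why the theorem holds.

    Put f(v) = exp(v^p).  Choose a bounded increasing function G, with
    derivative 1/F, and show that for some eps > 0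

      G(u(x,t)) - G(u(y,t)) >= eps/2 * (|y|^2 - |x|^2)   when |x| <= |y|.   (1)

    At x = 0 this reads G(u(y,t)) <= G(u(0,t)) - eps/2 |y|^2
    <= sup G - eps/2 |y|^2, which bounds u away from the origin uniformly in
    time, because G(v) tends to sup G only as v tends to infinity; so no point
    but 0 can be a blow-up point.  As u is radially nonincreasing, its maximum
    is u(0,t), and 0 is one.

    For a radial u, the inequality (1) is the integrated form of the bound
    u_r + eps r F(u) <= 0 of Friedman and McLeod.  The usual proof applies the
    maximum principle to u_r + eps r F(u), whose equation involves third
    derivatives of u.  The two-point form (1) is proved by
    a maximum principle for pairs (x,y), where only the derivatives of u that
    occur in its equation are used.  At an interior minimum over (x,y) of the
    difference of the two sides of (1), the first-order conditions
    give grad u(x) = - eps F(u(x)) x, and the same at y.  The function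
    |x|^2 / 2 has the constant Laplacian n, so the contributions of eps at x
    and at y cancel in the second-order conditions, and what remains is

      f(a)/F(a) - f(b)/F(b) >= 2 eps F'(b) (G(a) - G(b))   for 0 < b <= a,

    where a = u(x,t) and b = u(y,t).  This is the integrated form of the
    classical condition f' F - f F' >= 2 eps F F'.  It holds for

      F(v) = (3 + v^p)^(1 + 1/p) / 3,    G(v) = v / (3 + v^p)^(1/p)

    and eps <= 1/12 (lemma [reac_weight_sub_ge]).

    All comparisons go through one minimum principle, [parabolic_nonneg], for
    a function W(z,t) with z in a compact set.  It is applied
    - to u(x,t) - d/2 (R^2 - |x|^2), with d <= delta and n d <= 1.  As f >= 1,
      the subtracted function is a stationary subsolution.  The resulting
      lower barrier ([parabolic_lower_barrier]) yields (1) for |y| = R;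
    - to u(x,t) - u(y,t) on the pairs |x| <= |y| <= R, which shows that u is
      radial and radially nonincreasing ([radially_nonincreasing]).  A minimum
      with |x| = |y| is treated by moving x by h and y by Q h, where Q is the
      reflection exchanging x and y: the pair stays admissible, and the
      Laplacian is invariant under Q;
    - to the difference of the two sides of (1), on the same pairs
      ([squash_gap]).
    The hypothesis on the slope of the initial datum yields (1) at t = 0. *)

(** * Derivatives along lines *)

Lemma growth_cvg_is_derive (R : realType) (V : normedModType R) (f : V -> R)
    (x v : V) (l : R) :
  h^-1 *: (f (h *: v + x) - f x) @[h --> 0^'] --> l -> is_derive x v f l.
Proof. by move=> fl; split; [apply/cvg_ex; exists l | exact/cvg_lim]. Qed.

Lemma is_derive_growth_cvg (R : realType) (V : normedModType R) (f : V -> R)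
    (x v : V) (l : R) :
  is_derive x v f l -> h^-1 *: (f (h *: v + x) - f x) @[h --> 0^'] --> l.
Proof. by move=> [df <-]. Qed.

Lemma is_derive_line (R : realType) (V : normedModType R) (f : V -> R)
    (x v : V) (t l : R) :
  is_derive (x + t *: v) v f l -> is_derive t 1 (fun s => f (x + s *: v)) l.
Proof.
move=> /is_derive_growth_cvg fl; apply: growth_cvg_is_derive.
rewrite (_ : (fun h => _) = (fun h : R =>
  h^-1 *: (f (h *: v + (x + t *: v)) - f (x + t *: v)))) //.
by apply/funext => h; rewrite [h%:A]mulr1 scalerDl addrCA.
Qed.

Lemma line_MVT (R : realType) (V : normedModType R) (f : V -> R)
    (y v : V) (k : R) :
  (forall s : R, `|s| <= `|k| -> derivable f (y + s *: v) v) ->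
  exists2 s : R, `|s| <= `|k| &
    f (y + k *: v) - f y = k * 'D_v f (y + s *: v).
Proof.
move=> df; pose g s := f (y + s *: v).
have dg (s : R) : `|s| <= `|k| -> is_derive s 1 g ('D_v f (y + s *: v)).
  by move=> sk; apply: is_derive_line; exact/derivableP/df.
have g0 : g 0 = f y by rewrite /g scale0r addr0.
case: (ltgtP k 0) => [k0|k0|->]; last first.
- by exists 0; rewrite ?normr0// scale0r addr0 subrr mul0r.
- have sub (s : R) : s \in `[0, k] -> `|s| <= `|k|.
    by rewrite in_itv/= => /andP[s0 sk]; rewrite !ger0_norm// ltW.
  have [|s sk] := MVT k0 (fun s (h : s \in `]0, k[) =>
      dg s (sub s (subset_itv_oo_cc h))).
    apply: derivable_within_continuous => s /sub/dg; exact: @ex_derive.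
  rewrite g0 subr0 => ->; exists s; last by rewrite mulrC.
  exact/sub/subset_itv_oo_cc.
- have sub (s : R) : s \in `[k, 0] -> `|s| <= `|k|.
    by rewrite in_itv/= => /andP[s0 sk]; rewrite !ler0_norm ?lerN2// ltW.
  have [|s sk] := MVT k0 (fun s (h : s \in `]k, 0[) =>
      dg s (sub s (subset_itv_oo_cc h))).
    apply: derivable_within_continuous => s /sub/dg; exact: @ex_derive.
  rewrite g0 sub0r => E; exists s; first exact/sub/subset_itv_oo_cc.
  by rewrite -/(g k) -opprB E; ring.
Qed.

(** The increment along h (b + c v) is the increment along h b followed by one
    along h c v, to which the mean value theorem applies.  Continuity at the
    single point x is enough.  Adding the basis vectors one at a time turns
    this into differentiability of C^1 functions in every direction. *)
Lemma is_derive_addZ (R : realType) (V : normedModType R) (f : V -> R)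
    (x b v : V) (c l : R) :
  is_derive x b f l -> (\forall z \near x, derivable f z v) ->
  {for x, continuous ('D_v f)} ->
  is_derive x (b + c *: v) f (l + c * 'D_v f x).
Proof.
move=> /is_derive_growth_cvg fl df cf; apply: growth_cvg_is_derive.
rewrite (_ : (fun h => _) = (fun h : R => h^-1 *: (f (h *: b + x) - f x)
  + h^-1 *: (f (h *: (b + c *: v) + x) - f (h *: b + x)))); last first.
  by apply/funext => h; rewrite -scalerDr [_ + (f _ - _)]addrC addrA subrK.
apply: cvgD => //; apply/cvgrPdist_le => /= e e0.
have e1 : 0 < e / (`|c| + 1) by rewrite divr_gt0// ltr_wpDl.
have /cvgrPdist_le /(_ _ e1) cfe := cf.
have /nbhs_ballP[r /= r0 rP] : \forall z \near x,
    derivable f z v /\ `|'D_v f x - 'D_v f z| <= e / (`|c| + 1).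
  by near=> z; split; near: z.
have B0 : 0 < `|b| + `|c| * `|v| + 1.
  by rewrite ltr_wpDl// addr_ge0// mulr_ge0.
have near_r (h s : R) : `|h| < r / (`|b| + `|c| * `|v| + 1) ->
    `|s| <= `|h * c| -> ball x r (h *: b + x + s *: v).
  move=> hr; rewrite normrM => sh; rewrite -ball_normE/= opprD opprD.
  rewrite [- (h *: b) - x]addrC !addrA subrr sub0r -opprD normrN.
  rewrite (le_lt_trans (ler_normD _ _))// !normrZ.
  move: hr; rewrite ltr_pdivlMr// => /(le_lt_trans _); apply.
  rewrite !mulrDr mulr1 -addrA lerD2l -[leLHS]addr0 lerD// mulrA.
  by rewrite ler_wpM2r.
near=> h.
have hn0 : h != 0 by near: h; exact: nbhs_dnbhs_neq.
have hr : `|h| < r / (`|b| + `|c| * `|v| + 1).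
  near: h; apply/nbhs_dnbhs.
  exists (r / (`|b| + `|c| * `|v| + 1)) => /=; first exact: divr_gt0.
  by move=> h /=; rewrite sub0r normrN.
have [s sh] := @line_MVT R V f (h *: b + x) v (h * c)
  (fun s sh => (rP _ (near_r _ _ hr sh)).1).
have -> : h *: (b + c *: v) + x = h *: b + x + (h * c) *: v.
  by rewrite scalerDr scalerA addrAC.
move=> ->.
rewrite -[_ *: _]/(_ * _) -mulrA mulKf// -mulrBr normrM.
have [_] := rP _ (near_r h s hr sh); rewrite ler_pdivlMr ?ltr_wpDl//.
move=> /(le_trans _); apply; rewrite mulrC.
by rewrite ler_wpM2l// lerDl.
Unshelve. all: by end_near. Qed.

(** If the second derivative c were negative, then g1 < 0 just to the right of
    0, where g would decrease strictly. *)
Lemma second_derivative_test (R : realType) (g g1 : R -> R) (c : R) :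
  (\forall s \near 0, is_derive s (1 : R) g (g1 s)) ->
  is_derive (0 : R) 1 g1 c -> (\forall s \near 0, g 0 <= g s) -> g1 0 = 0 /\ 0 <= c.
Proof.
move=> dg dg1 gmin.
have /nbhs_ballP[e /= e0 eP] : \forall s \near 0,
    is_derive s (1 : R) g (g1 s) /\ g 0 <= g s.
  by near=> s; split; near: s.
have {}eP (s : R) : `|s| < e -> is_derive s 1 g (g1 s) /\ g 0 <= g s.
  by move=> se; apply: eP; rewrite -ball_normE/= sub0r normrN.
have g10 : g1 0 = 0.
  have [dg0 _] := eP 0 (etrans (congr1 (fun z => z < e) (normr0 _)) e0).
  have := @derive1_at_min R g (- e) e 0.
  rewrite ge0_cp ?ltW// => /(_ isT); case.
  - by move=> t; rewrite in_itv/= -ltr_norml => /eP[/(@ex_derive)].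
  - by rewrite in_itv/= oppr_lt0 e0.
  - by move=> t; rewrite in_itv/= -ltr_norml => /eP[].
  - by move=> _; rewrite (@derive_val _ _ _ _ _ _ _ dg0).
split=> //; rewrite leNgt; apply/negP => c0.
have /cvgrPdist_lt/(_ (- c)) := is_derive_growth_cvg dg1.
rewrite oppr_gt0 => /(_ c0); rewrite near_withinE => /nbhs_ballP[r /= r0 rP].
pose k := Num.min e r / 2.
have m0 : 0 < Num.min e r by rewrite lt_min e0.
have k0 : 0 < k by rewrite divr_gt0.
have km : k < Num.min e r by rewrite /k; lra.
have [ke kr] : k < e /\ k < r by move: km; rewrite lt_min => /andP.
have sub (s : R) : s \in `[0, k] -> `|s| < e.
  by rewrite in_itv/= => /andP[s0 sk]; rewrite ger0_norm// (le_lt_trans sk).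
have [|s sk] := MVT k0 (fun s (h : s \in `]0, k[) =>
      (eP s (sub s (subset_itv_oo_cc h))).1).
  by apply: derivable_within_continuous => s /sub/eP[/(@ex_derive)].
move: sk; rewrite in_itv/= subr0 => /andP[s0 sk] gk.
have /eP[_] : `|k| < e by rewrite gtr0_norm.
rewrite -subr_ge0 gk pmulr_lge0// leNgt => /negP; apply.
have := rP s; rewrite -ball_normE/= sub0r normrN gtr0_norm// (lt_trans sk kr).
move=> /(_ isT (lt0r_neq0 s0)); rewrite g10 subr0 addr0 [s%:A]mulr1.
rewrite -[_ *: _]/(_ * _) ltr_norml opprK => /andP[+ _].
by rewrite ltrBrDr gtrDl pmulr_rlt0 ?invr_gt0.
Unshelve. all: by end_near. Qed.

(** * Second derivatives of C^2 functions in arbitrary directions *)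

Section Directional.
Variables (R : realType) (n : nat).
Implicit Types (U : set 'rV[R]_n) (f : 'rV[R]_n -> R) (x a : 'rV[R]_n).

Definition grad_form f x a : R := \sum_(i < n) a ord0 i * partial i f x.

Definition hess_form f x a : R :=
  \sum_(i < n) a ord0 i * grad_form (partial i f) x a.

Lemma is_derive_grad_form U f x a : open U -> U x ->
  (forall y, U y -> forall i, derivable f y (basis_vec R i)) ->
  (forall i, {for x, continuous (partial i f)}) ->
  is_derive x a f (grad_form f x a).
Proof.
move=> oU Ux df cf; rewrite /grad_form [a in is_derive _ a]row_sum_delta.
rewrite unlock; elim: (index_enum _) => [|i r IH] /=; first exact: is_derive0.
rewrite addrC [X in is_derive _ _ _ X]addrC; apply: is_derive_addZ IH _ (cf i).
by apply: filterS (open_nbhs_nbhs (conj oU Ux)) => y Uy; exact: df.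
Qed.

Lemma line_C2 U f x a : open U -> Ck_on 2 U f -> U x ->
  (\forall s \near 0, is_derive s (1 : R) (fun s => f (x + s *: a))
                        (grad_form f (x + s *: a) a)) /\
  is_derive (0 : R) 1 (fun s => grad_form f (x + s *: a) a) (hess_form f x a).
Proof.
move=> oU cf Ux.
have near_line : \forall s \near (0 : R), U (x + s *: a).
  have : x + (s : R) *: a @[s --> 0] --> x.
    rewrite -[X in _ --> X]addr0 -(scale0r a).
    apply: cvgD; [exact: cvg_cst | exact: scalel_continuous].
  by apply; exact: open_nbhs_nbhs.
split.
  near=> s; apply: is_derive_line.
  apply: (@is_derive_grad_form U) => //; first by near: s.
  - by move=> y Uy i; have [_ /(_ isT)] := cf [::] isT y Uy; exact.
  - by move=> i; have [] // := cf [:: i] isT (x + s *: a); near: s.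
have -> : (fun s => grad_form f (x + s *: a) a) =
    \sum_(i < n) (fun s : R => a ord0 i * partial i f (x + s *: a)).
  by apply/funext => s; rewrite fct_sumE.
apply: is_derive_sum => i.
rewrite -[_ * grad_form _ _ _]/(_ *: _).
apply: (@is_deriveZ _ _ _ (fun s : R => partial i f (x + s *: a))).
apply: is_derive_line; rewrite scale0r addr0.
apply: (@is_derive_grad_form U) => //.
- by move=> y Uy j; have [_ /(_ isT)] := cf [:: i] isT y Uy; exact.
- by move=> j; have [] := cf [:: j; i] isT x Ux.
Unshelve. all: by end_near. Qed.

Lemma grad_form_basis f x i : grad_form f x (basis_vec R i) = partial i f x.
Proof.
rewrite /grad_form (bigD1 i)//= big1 ?addr0 => [|j ji].
  by rewrite mxE !eqxx mul1r.
by rewrite mxE (negbTE ji) andbF mul0r.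
Qed.

Lemma hess_form_basis f x i :
  hess_form f x (basis_vec R i) = partial i (partial i f) x.
Proof.
rewrite /hess_form (bigD1 i)//= big1 ?addr0 => [|j ji].
  by rewrite mxE !eqxx mul1r grad_form_basis.
by rewrite mxE (negbTE ji) andbF mul0r.
Qed.

(** The trace of the Hessian does not depend on the orthonormal basis; the basis
    consists here of the rows of Q. *)
Lemma laplacian_orthonormal f x (Q : 'M[R]_n) : Q^T *m Q = 1%:M ->
  laplacian f x = \sum_(k < n) hess_form f x (row k Q).
Proof.
move=> QQ; rewrite /hess_form exchange_big; apply: eq_bigr => i _ /=.
transitivity (\sum_(j < n) (Q^T *m Q) i j * partial j (partial i f) x).
  rewrite QQ (bigD1 i)//= big1 ?addr0 => [|j ji].
    by rewrite mxE eqxx mul1r.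
  by rewrite mxE eq_sym (negbTE ji) mul0r.
rewrite /grad_form; under [RHS]eq_bigr do rewrite mulr_sumr.
rewrite [RHS]exchange_big; apply: eq_bigr => j _ /=.
rewrite mxE mulr_suml; apply: eq_bigr => k _.
by rewrite !mxE mulrA.
Qed.

End Directional.

(** * A minimum principle on a compact set *)

Section ParabolicMinimum.
Variables (R : realType) (Z : topologicalType).

(** Consider the minimum over K x [0,t1] of exp(-(L+1)t) W.  If it is negative,
    it is attained at some t > 0, and z minimizes W(.,t).  The exponential
    factor makes the lower bound L W <= dW/dt, at negative values of W, a
    strictly positive time derivative, so that smaller values occur just
    before t. *)
Lemma parabolic_nonneg (K : set Z) (W : Z -> R -> R) (t1 L : R) :
  compact K ->
  {within K `*` `[0, t1], continuous (fun z : Z * R => W z.1 z.2)} ->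
  (forall z, K z -> 0 <= W z 0) ->
  (forall z t, K z -> 0 < t <= t1 -> W z t < 0 ->
    (forall z', K z' -> W z t <= W z' t) ->
    exists2 l, is_derive t 1 (W z) l & L * W z t <= l) ->
  forall z t, K z -> 0 <= t <= t1 -> 0 <= W z t.
Proof.
move=> cK cW W0 Wmin z0 t0 Kz0 t0t1; rewrite leNgt; apply/negP => Wneg.
pose M := L + 1; pose V (z : Z * R) := expR (- M * z.2) * W z.1 z.2.
have cV : {within K `*` `[0, t1], continuous V}.
  move=> z; apply: (@continuousM R (subspace (K `*` `[0, t1]))
    (fun z : Z * R => expR (- M * z.2)) (fun z : Z * R => W z.1 z.2));
    last exact: cW.
  apply: (@continuous_subspaceT _ _ _ (fun z : Z * R => expR (- M * z.2))) => y.
  apply: (@continuous_comp _ _ _ (fun z : Z * R => - M * z.2) expR).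
    by apply: continuousM; [exact: cst_continuous | exact: cvg_snd].
  exact: continuous_expR.
have Kt0 : (K `*` `[0, t1]) (z0, t0) by split => //=; rewrite in_itv.
have [[z t]] := compact_EVT_min (ex_intro _ _ Kt0)
  (compact_setX cK (@segment_compact _ 0 t1)) cV.
rewrite inE => -[/= Kz]; rewrite in_itv/= => /andP[t_ge0 t_le] Vmin.
have {}Vmin z' t' : K z' -> 0 <= t' <= t1 -> V (z, t) <= V (z', t').
  by move=> Kz' tt; apply: Vmin; rewrite inE; split => //=; rewrite in_itv.
have Wzt : W z t < 0.
  rewrite -(pmulr_rlt0 _ (expR_gt0 (- M * t))).
  by rewrite (le_lt_trans (Vmin _ _ Kz0 t0t1))// pmulr_rlt0 ?expR_gt0.
have t_gt0 : 0 < t.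
  by rewrite lt_neqAle t_ge0 andbT; apply/eqP => t00; move: Wzt;
    rewrite -t00 ltNge W0.
have [||l dW Ll] := Wmin z t Kz _ Wzt; first by rewrite t_gt0.
  move=> z' Kz'; rewrite -(ler_pM2l (expR_gt0 (- M * t))).
  by apply: Vmin => //; rewrite t_ge0.
have dV : is_derive t 1 (fun s => expR (- M * s) * W z s)
    (expR (- M * t) * (l - M * W z t)).
  have dE : is_derive t 1 (fun s : R => expR (- M * s)) (expR (- M * t) * - M).
    apply: (@is_derive1_comp _ expR (fun s => - M * s)).
    rewrite -[X in is_derive _ _ _ X]mulr1.
    exact: (@is_deriveZ _ _ _ id).
  have dp := is_deriveM dE dW; apply: (is_derive_eq dp).
  by rewrite /GRing.scale/=; ring.
have dV0 : 0 < expR (- M * t) * (l - M * W z t).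
  by rewrite mulr_gt0 ?expR_gt0// subr_gt0 (lt_le_trans _ Ll)// ltr_nM2r// ltrDl.
have := is_derive_growth_cvg dV.
move=> /cvgrPdist_lt/(_ _ dV0); rewrite near_withinE => /nbhs_ballP[r /= r0 rP].
pose k := Num.min r t / 2.
have m0 : 0 < Num.min r t by rewrite lt_min r0.
have k0 : 0 < k by rewrite divr_gt0.
have [kr kt] : k < r /\ k < t.
  by apply/andP; rewrite -lt_min /k; lra.
have := rP (- k); rewrite -ball_normE/= sub0r opprK gtr0_norm// kr.
move=> /(_ isT); rewrite oppr_eq0 (lt0r_neq0 k0) => /(_ isT).
have -> : (- k)%:A + t = t - k :> R by rewrite [_%:A]mulr1 addrC.
move=> /(le_lt_trans (ler_norm _)).
rewrite gtrBl -[_ *: _]/(_ * _) invrN mulNr oppr_gt0 pmulr_rlt0 ?invr_gt0//.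
rewrite subr_lt0 ltNge => /negP; apply.
apply: Vmin => //; rewrite subr_ge0 (ltW kt)/=.
by rewrite lerBlDr (le_trans t_le)// lerDl ltW.
Qed.

End ParabolicMinimum.

Lemma within_continuous_comp (X Y S : topologicalType) (A : set X) (B : set Y)
    (h : X -> Y) (f : Y -> S) :
  {within A, continuous h} -> (forall x, A x -> B (h x)) ->
  {within B, continuous f} -> {within A, continuous (f \o h)}.
Proof.
move=> /subspace_continuousP ch AB /subspace_continuousP cf.
apply/subspace_continuousP => x Ax.
apply: cvg_comp (cf _ (AB _ Ax)) => S' BS'.
have := ch x Ax _ BS'; rewrite /within/= !nbhs_simpl/=.
by apply: filterS => y /[swap] Ay /(_ Ay); apply; exact: AB.
Qed.

(** * Euclidean geometry *)

Section Euclidean.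
Variables (R : realType) (n : nat).
Implicit Types (x y z : 'rV[R]_n) (r : R).

Definition sqnorm x : R := \sum_(i < n) x ord0 i ^+ 2.

Lemma sqnorm_ge0 x : 0 <= sqnorm x.
Proof. by apply: sumr_ge0 => i _; exact: sqr_ge0. Qed.

Lemma enorm_ge0 x : 0 <= enorm x.
Proof. exact: sqrtr_ge0. Qed.

Lemma sqr_enorm x : enorm x ^+ 2 = sqnorm x.
Proof. by rewrite sqr_sqrtr// sqnorm_ge0. Qed.

Lemma enorm_le x y : (enorm x <= enorm y) = (sqnorm x <= sqnorm y).
Proof. by rewrite -!sqr_enorm ler_sqr// nnegrE enorm_ge0. Qed.

Lemma enorm0 : enorm (0 : 'rV[R]_n) = 0.
Proof.
by rewrite /enorm big1 ?sqrtr0// => i _; rewrite mxE expr0n.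
Qed.

Lemma enorm_eq0 x : enorm x = 0 -> x = 0.
Proof.
move=> x0; apply/rowP => i; rewrite mxE; apply/eqP.
have : sqnorm x == 0 by rewrite -sqr_enorm x0 expr0n.
rewrite psumr_eq0 => [/allP/(_ i (mem_index_enum _))/=|j _]; last exact: sqr_ge0.
by rewrite sqrf_eq0.
Qed.

Lemma coord_le_enorm x i : `|x ord0 i| <= enorm x.
Proof.
rewrite -ler_sqr ?nnegrE ?enorm_ge0// real_normK ?num_real// sqr_enorm.
by rewrite /sqnorm (bigD1 i)//= lerDl sumr_ge0// => j _; exact: sqr_ge0.
Qed.

Lemma enorm_scale_basis r i : enorm (r *: basis_vec R (i : 'I_n)) = `|r|.
Proof.
rewrite /enorm (bigD1 i)//= big1 ?addr0 => [|j ji].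
  by rewrite !mxE !eqxx mulr1 sqrtr_sqr.
by rewrite !mxE (negbTE ji) andbF mulr0 expr0n.
Qed.

Lemma continuous_sqnorm : continuous sqnorm.
Proof.
have -> : sqnorm = \sum_(i < n) (fun x : 'rV[R]_n => x ord0 i ^+ 2).
  by apply/funext => x; rewrite fct_sumE.
elim/big_ind: _ => [x|f g cf cg x|i _ x]; first exact: (@cst_continuous _ _ (0 : R) x).
  exact: continuousD (cf x) (cg x).
apply: (@continuous_comp _ _ _ (fun x : 'rV[R]_n => x ord0 i)
  (fun s : R => s ^+ 2)); first exact: coord_continuous.
exact: exprn_continuous.
Qed.

Lemma continuous_enorm : continuous (@enorm R n).
Proof.
move=> x; apply: (@continuous_comp _ _ _ sqnorm Num.sqrt).
  exact: continuous_sqnorm.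
exact: sqrt_continuous.
Qed.

Lemma open_eball r : open (@eball R n r).
Proof.
by apply: (@open_comp _ _ _ [set s : R | s < r]) (@open_lt _ r) => x _;
  exact: continuous_enorm.
Qed.

Lemma compact_ecball r : compact (@ecball R n r).
Proof.
apply: bounded_closed_compact; last first.
  by apply: (@closed_comp _ _ _ [set s : R | s <= r]) (@closed_le _ r) => x _;
    exact: continuous_enorm.
exists r; split; first exact: num_real.
move=> M rM x /= xr; rewrite [leLHS]/Num.Def.normr/= mx_normrE; apply/bigmax_leP.
split=> [|[i j] _ /=]; first by rewrite (le_trans (enorm_ge0 x))// (le_trans xr)// ltW.
rewrite (ord1 i) (le_trans (coord_le_enorm x j))// (le_trans xr)// ltW//.
Qed.

(** The domain of the two-point comparisons. *)
Definition ordered_pairs r : set ('rV[R]_n * 'rV[R]_n) :=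
  [set z | enorm z.1 <= enorm z.2 /\ enorm z.2 <= r].

Lemma compact_ordered_pairs r : compact (ordered_pairs r).
Proof.
have c1 : continuous (fun z : 'rV[R]_n * 'rV[R]_n => enorm z.1 - enorm z.2).
  move=> z; apply: cvgB.
    apply: (@continuous_comp _ _ _ fst (@enorm R n)); first exact: cvg_fst.
    exact: continuous_enorm.
  apply: (@continuous_comp _ _ _ snd (@enorm R n)); first exact: cvg_snd.
  exact: continuous_enorm.
have c2 : continuous (fun z : 'rV[R]_n * 'rV[R]_n => enorm z.2).
  move=> z; apply: (@continuous_comp _ _ _ snd (@enorm R n)).
    exact: cvg_snd.
  exact: continuous_enorm.
apply: subclosed_compact (compact_setX (@compact_ecball r)
    (@compact_ecball r)) _; last first.
  by move=> [x y] [/= xy yr]; split => //=; exact: le_trans xy yr.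
rewrite (_ : ordered_pairs r =
  (fun z : 'rV[R]_n * 'rV[R]_n => enorm z.1 - enorm z.2) @^-1` [set s : R | s <= 0] `&`
  (fun z : 'rV[R]_n * 'rV[R]_n => enorm z.2) @^-1` [set s : R | s <= r]).
  apply: closedI.
    by apply: (@closed_comp _ _ _ [set s : R | s <= 0]) (@closed_le _ 0) => z _;
      exact: c1.
  by apply: (@closed_comp _ _ _ [set s : R | s <= r]) (@closed_le _ r) => z _;
    exact: c2.
by apply/seteqP; split => [z [z12 z2]|z [/= z12 z2]]; split => //=;
  move: z12; rewrite subr_le0.
Qed.

Lemma sqnormE x : sqnorm x = (x *m x^T) ord0 ord0.
Proof. by rewrite mxE; apply: eq_bigr => i _; rewrite !mxE expr2. Qed.

Lemma sqnorm_line x i r :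
  sqnorm (x + r *: basis_vec R i) = sqnorm x + r * (2 * x ord0 i) + r ^+ 2.
Proof.
rewrite /sqnorm (bigD1 i)//= [in RHS](bigD1 i)//= !mxE !eqxx/=.
rewrite (eq_bigr (fun j => x ord0 j ^+ 2)) => [|j ji]; first by ring.
by rewrite !mxE (negbTE ji) andbF mulr0 addr0.
Qed.

Lemma enorm_isometry (Q : 'M[R]_n) x : Q^T *m Q = 1%:M ->
  enorm (x *m Q) = enorm x.
Proof.
move=> /mulmx1C QQ; congr Num.sqrt; rewrite -!/(sqnorm _) !sqnormE.
by rewrite trmx_mul mulmxA -[x *m Q *m _]mulmxA QQ mulmx1.
Qed.

(** Q is the reflection in the hyperplane orthogonal to x - y. *)
Lemma householder x y : enorm x = enorm y -> x != y ->
  exists2 Q : 'M[R]_n, Q^T *m Q = 1%:M & x *m Q = y.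
Proof.
move=> xy x_neq_y; pose b := x - y.
have b0 : sqnorm b != 0.
  rewrite -sqr_enorm sqrf_eq0; apply: contra x_neq_y => /eqP/enorm_eq0/eqP.
  by rewrite subr_eq0.
have bb : b *m b^T = (sqnorm b)%:M.
  by rewrite [LHS]mx11_scalar sqnormE.
have xb : x *m b^T = (sqnorm b / 2)%:M.
  rewrite [LHS]mx11_scalar sqnormE; congr (_ %:M).
  have -> : (b *m b^T) = x *m x^T - y *m x^T - (x *m y^T - y *m y^T).
    by rewrite /b linearB/= mulmxBr !mulmxBl.
  have -> : x *m b^T = x *m x^T - x *m y^T by rewrite linearB/= mulmxBr.
  have e1 : (x *m x^T) ord0 ord0 = (y *m y^T) ord0 ord0.
    by rewrite -!sqnormE -!sqr_enorm xy.
  have e2 : (y *m x^T) ord0 ord0 = (x *m y^T) ord0 ord0.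
    by rewrite -[y *m x^T]trmxK trmx_mul trmxK mxE.
  by rewrite !mxE in e1 e2 *; rewrite e1 e2; field.
(* x Q = x - 2 (x.b) / |b|^2 b, and 2 x.b = |b|^2 because |x| = |y| *)
exists (1%:M - (2 / sqnorm b) *: (b^T *m b)); last first.
  rewrite mulmxBr mulmx1 -scalemxAr mulmxA xb mul_scalar_mx scalerA.
  rewrite (_ : _ * _ = 1); last by field.
  by rewrite scale1r /b opprB addrC subrK.
have PP : (b^T *m b) *m (b^T *m b) = sqnorm b *: (b^T *m b).
  by rewrite mulmxA -[b^T *m b *m b^T]mulmxA bb mul_mx_scalar scalemxAl.
have PT : (b^T *m b)^T = b^T *m b by rewrite trmx_mul trmxK.
move: PP PT; move: (b^T *m b) => P PP PT.
rewrite [_^T]linearB/= trmx1 linearZ/= PT.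
rewrite mulmxBl mul1mx mulmxBr mulmx1 -scalemxAl -scalemxAr PP !scalerA.
rewrite -addrA -[RHS]addr0; congr (_ + _).
rewrite -scalerBl -!scaleNr -scalerDl.
set c := (X in X *: P); suff -> : c = 0 by rewrite scale0r.
by rewrite /c /GRing.scale/=; field.
Qed.

End Euclidean.

(** * The reaction term and its weight *)

Lemma is_derive_quot_sub (R : realType) (f g h : R -> R) (s df dg dh k : R) :
  is_derive s 1 f df -> is_derive s 1 g dg -> is_derive s 1 h dh -> g s != 0 ->
  is_derive s 1 (fun s => f s / g s - k * h s)
    ((df * g s - f s * dg) / g s ^+ 2 - k * dh).
Proof.
move=> Df Dg Dh g0; have dV := is_deriveV g0 Dg; have dM := is_deriveM Df dV.
have dG := is_deriveM (is_derive_cst k s 1) Dh; have dD := is_deriveB dM dG.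
by apply: (is_derive_eq dD); rewrite /GRing.scale/=; field.
Qed.

Section Reaction.
Variables (R : realType) (p : R).
Hypothesis p_gt1 : 1 < p.
Implicit Types a b u eps : R.

Let p_gt0 : 0 < p. Proof. exact: lt_trans p_gt1. Qed.
Let p_neq0 : p != 0. Proof. exact: lt0r_neq0. Qed.

Definition reac u : R := expR (u `^ p).
(** With w = u^p, the condition p (3 + w) > p + 1 is what makes reac / weight
    increasing; this is why u^p is shifted, and 3 leaves a margin that does
    not depend on p. *)
Definition shifted_pow u : R := 3 + u `^ p.
Definition shifted_root u : R := shifted_pow u `^ p^-1.
(** The function F of the introduction. *)
Definition weight u : R := shifted_pow u * shifted_root u / 3.
Definition dweight u : R := (p + 1) * u `^ (p - 1) * shifted_root u / 3.
(** The function G of the introduction: its derivative is 1 / weight. *)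
Definition squash u : R := u / shifted_root u.

Lemma shifted_pow_gt0 u : 0 < shifted_pow u.
Proof. by rewrite /shifted_pow ltr_wpDr ?powR_ge0. Qed.

Lemma shifted_root_gt0 u : 0 < shifted_root u.
Proof. by rewrite powR_gt0 ?shifted_pow_gt0. Qed.

Lemma weight_gt0 u : 0 < weight u.
Proof. by rewrite /weight divr_gt0// mulr_gt0 ?shifted_pow_gt0 ?shifted_root_gt0. Qed.

Lemma reac_ge1 u : 1 <= reac u.
Proof. by rewrite -expR0 ler_expR powR_ge0. Qed.

Lemma shifted_pow_le a b : 0 <= a -> a <= b -> shifted_pow a <= shifted_pow b.
Proof.
by move=> a0 ab; rewrite lerD2l ge0_ler_powR ?nnegrE// ?(ltW p_gt0)// (le_trans a0).
Qed.

Lemma shifted_root_le a b : 0 <= a -> a <= b -> shifted_root a <= shifted_root b.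
Proof.
move=> a0 ab; apply: ge0_ler_powR; rewrite ?nnegrE ?(ltW (shifted_pow_gt0 _))//.
  by rewrite invr_ge0 ltW.
exact: shifted_pow_le.
Qed.

Lemma weight_le a b : 0 <= a -> a <= b -> weight a <= weight b.
Proof.
move=> a0 ab; apply: ler_wpM2r; first by rewrite invr_ge0.
by apply: ler_pM; rewrite ?shifted_pow_le ?shifted_root_le// ?powR_ge0// ltW// shifted_pow_gt0.
Qed.

Lemma dweight_le a b : 0 <= a -> a <= b -> dweight a <= dweight b.
Proof.
move=> a0 ab; apply: ler_wpM2r; first by rewrite invr_ge0.
have p10 : 0 <= p + 1 by rewrite addr_ge0// ltW.
apply: ler_pM; rewrite ?shifted_root_le ?powR_ge0// ?mulr_ge0 ?powR_ge0//.
rewrite ler_wpM2l//; apply: ge0_ler_powR; rewrite ?nnegrE//.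
  by rewrite subr_ge0 ltW.
exact: le_trans a0 ab.
Qed.

Lemma continuous_powR_ge0 :
  {within `[0, +oo[, continuous (fun u : R => u `^ p)}.
Proof.
apply/continuous_within_itvcyP; split => [u|].
  rewrite in_itv/= andbT => u0; apply: differentiable_continuous.
  by apply/derivable1_diffP; apply: (@ex_derive _ _ _ _ _ _ _ (is_derive1_powR p u0)).
by rewrite powR0//; exact: powR_cvg0.
Qed.

Lemma is_derive_shifted_pow u : 0 < u -> is_derive u 1 shifted_pow (p * u `^ (p - 1)).
Proof.
move=> u0; have dp := is_derive1_powR p u0.
have dD := is_deriveD (is_derive_cst (3 : R) u 1) dp.
by apply: (is_derive_eq dD); rewrite add0r.
Qed.

Lemma is_derive_shifted_root u : 0 < u ->
  is_derive u 1 shifted_root (u `^ (p - 1) * shifted_root u / shifted_pow u).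
Proof.
move=> u0; have dg := is_derive_shifted_pow u0.
have dr := is_derive1_powR p^-1 (shifted_pow_gt0 u).
have dc := is_derive1_comp dr dg; apply: (is_derive_eq dc).
rewrite /shifted_root powRD ?(lt0r_neq0 (shifted_pow_gt0 u)) ?implybT//.
rewrite powRN powRr1 ?ltW ?shifted_pow_gt0//.
by have := lt0r_neq0 (shifted_pow_gt0 u) => g0; field; rewrite g0.
Qed.

Lemma is_derive_weight u : 0 < u -> is_derive u 1 weight (dweight u).
Proof.
move=> u0; have dg := is_derive_shifted_pow u0; have dr := is_derive_shifted_root u0.
have dM := is_deriveM dg dr.
have dZ := is_deriveM dM (is_derive_cst (3^-1 : R) u 1).
apply: (is_derive_eq dZ); rewrite /dweight /GRing.scale/=.
by have := lt0r_neq0 (shifted_pow_gt0 u) => g0; field; rewrite g0.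
Qed.

Lemma powR_predM u : 0 < u -> u * u `^ (p - 1) = u `^ p.
Proof.
move=> u0; rewrite -{1}(powRr1 (ltW u0)) -powRD ?(lt0r_neq0 u0) ?implybT//.
by congr (_ `^ _); ring.
Qed.

Lemma is_derive_squash u : 0 < u -> is_derive u 1 squash (weight u)^-1.
Proof.
move=> u0; have dr := is_derive_shifted_root u0.
have dV := is_deriveV (lt0r_neq0 (shifted_root_gt0 u)) dr.
have dM := is_deriveM (is_derive_id u 1) dV.
apply: (is_derive_eq dM); rewrite /weight /GRing.scale/=.
have g0 := lt0r_neq0 (shifted_pow_gt0 u); have q0 := lt0r_neq0 (shifted_root_gt0 u).
have pu := powR_predM u0.
have -> : u `^ (p - 1) = (shifted_pow u - 3) / u.
  by rewrite /shifted_pow -pu; field; rewrite lt0r_neq0.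
by field; rewrite q0 g0 lt0r_neq0.
Qed.

Lemma continuous_shifted_root : {within `[0, +oo[, continuous shifted_root}.
Proof.
apply: (@within_continuous_comp _ _ _ _ [set s : R | 0 < s] shifted_pow
  (fun s => s `^ p^-1)).
- apply/subspace_continuousP => s s0; apply: cvgD; first exact: cvg_cst.
  by move/subspace_continuousP : continuous_powR_ge0; exact.
- by move=> s _; exact: shifted_pow_gt0.
- apply: continuous_in_subspaceT => s; rewrite inE/= => s0.
  apply: differentiable_continuous; apply/derivable1_diffP.
  by apply: (@ex_derive _ _ _ _ _ _ _ (is_derive1_powR p^-1 s0)).
Qed.

Lemma continuous_squash : {within `[0, +oo[, continuous squash}.
Proof.
apply/subspace_continuousP => s s0; apply: cvgM; first exact: cvg_within.
apply: cvgV; first exact/lt0r_neq0/shifted_root_gt0.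
by move/subspace_continuousP : continuous_shifted_root; exact.
Qed.

Lemma subset_itvcc_ge0 a b : 0 <= a -> `[a, b] `<=` `[0, +oo[.
Proof.
by move=> a0 s /=; rewrite !in_itv/= andbT => /andP[+ _]; exact: le_trans.
Qed.

(** The weight is nondecreasing, so on [b, a] the derivative of squash is
    smallest at a. *)
Lemma squash_sub_ge a b : 0 <= b -> b <= a ->
  (a - b) / weight a <= squash a - squash b.
Proof.
move=> b0 ba; have [||c] := @MVT_segment _ squash (fun s => (weight s)^-1) b a ba.
- move=> s; rewrite in_itv/= => /andP[bs _]; apply: is_derive_squash.
  exact: le_lt_trans b0 bs.
- exact: continuous_subspaceW (@subset_itvcc_ge0 b a b0) continuous_squash.
rewrite in_itv/= => /andP[bc ca] ->; rewrite mulrC.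
apply: ler_wpM2r; first by rewrite subr_ge0.
rewrite lef_pV2 ?posrE; first last.
- exact: weight_gt0.
- exact: weight_gt0.
- by apply: weight_le => //; exact: le_trans b0 bc.
Qed.

Lemma squash_le a b : 0 <= b -> b <= a -> squash b <= squash a.
Proof.
move=> b0 ba; rewrite -subr_ge0; apply: le_trans (squash_sub_ge b0 ba).
by rewrite divr_ge0 ?subr_ge0// ltW ?weight_gt0.
Qed.

(** The denominator exceeds (u^p)^(1/p) = u. *)
Lemma squash_lt1 u : 0 <= u -> squash u < 1.
Proof.
move=> u0; rewrite ltr_pdivrMr ?shifted_root_gt0// mul1r.
have {1}-> : u = (u `^ p) `^ p^-1.
  by rewrite -powRrM divff// powRr1.
apply: gt0_ltr_powR; rewrite ?invr_gt0 ?nnegrE ?powR_ge0 ?(ltW (shifted_pow_gt0 _))//.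
by rewrite /shifted_pow ltrDr.
Qed.

Lemma squash0 : squash 0 = 0.
Proof. by rewrite /squash mul0r. Qed.

Lemma is_derive_reac u : 0 < u ->
  is_derive u 1 reac (p * u `^ (p - 1) * reac u).
Proof.
move=> u0; have dp := is_derive1_powR p u0.
have dc := @is_derive1_comp R (@expR R) (fun s : R => s `^ p) _ _ _ (is_derive_expR (u `^ p)) dp.
by apply: (is_derive_eq dc); rewrite mulrC.
Qed.

Lemma reac_lipschitz M : exists2 L, 0 <= L &
  forall a b, 0 <= a -> a <= b -> b <= M -> reac b - reac a <= L * (b - a).
Proof.
exists (p * M `^ (p - 1) * reac M).
  by rewrite !mulr_ge0 ?powR_ge0 ?expR_ge0// ltW.
move=> a b a0 ab bM.
have [||c] := @MVT_segment _ reac (fun u => p * u `^ (p - 1) * reac u) a b ab.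
- move=> s; rewrite in_itv/= => /andP[bs _]; apply: is_derive_reac.
  exact: le_lt_trans a0 bs.
- apply: continuous_subspaceW (@subset_itvcc_ge0 a b a0) _.
  apply: (@within_continuous_comp _ _ _ _ setT (fun u => u `^ p) expR) => //.
    exact: continuous_powR_ge0.
  exact/continuous_subspaceT/continuous_expR.
rewrite in_itv/= => /andP[ac cb] ->.
apply: ler_wpM2r; first by rewrite subr_ge0.
have [c0 cM] : 0 <= c /\ c <= M by split; [exact: le_trans ac|exact: le_trans bM].
have M0 := le_trans c0 cM.
apply: ler_pM; rewrite ?mulr_ge0 ?powR_ge0 ?expR_ge0 ?(ltW p_gt0)//.
  apply: ler_wpM2l; rewrite ?(ltW p_gt0)//; apply: ge0_ler_powR; rewrite ?nnegrE//.
  by rewrite subr_ge0 ltW.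
rewrite ler_expR; apply: ge0_ler_powR; rewrite ?nnegrE//; exact: ltW.
Qed.

Lemma weight_le_sqr u : weight u <= shifted_pow u ^+ 2 / 3.
Proof.
apply: ler_wpM2r; first by rewrite invr_ge0.
rewrite expr2; apply: ler_wpM2l; first exact/ltW/shifted_pow_gt0.
rewrite -[leRHS]powRr1 ?(ltW (shifted_pow_gt0 _))//; apply: ler_powR.
  by rewrite /shifted_pow; have := powR_ge0 u p; lra.
by rewrite invf_le1 ?ltW.
Qed.

(** Up to the factor u^(p-1) (3 + w)^(1/p) / 3, where w = u^p, the inequality
    reads 2 eps (p + 1) weight(u) <= exp(w) (p (3 + w) - (p + 1)).  The right
    side is at least p (1 + w)^2, as exp(w) >= 1 + w.  The left
    side is at most p (3 + w)^2 / 9 <= p (1 + w)^2, as weight(u) <= (3 + w)^2 / 3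
    and eps <= 1/12. *)
Lemma reac_weight_mono u eps : 0 < u -> 0 < eps <= 12^-1 ->
  2 * eps * dweight u * weight u <=
  p * u `^ (p - 1) * reac u * weight u - reac u * dweight u.
Proof.
move=> u0 /andP[eps0 eps1]; have p1 := p_gt1.
have E0 : 0 <= u `^ (p - 1) * shifted_root u / 3.
  by rewrite divr_ge0// mulr_ge0 ?powR_ge0.
have H : 2 * eps * (p + 1) * weight u <= reac u * (p * shifted_pow u - (p + 1)).
  have g3 : 3 <= shifted_pow u by rewrite lerDl powR_ge0.
  have f1 : shifted_pow u - 2 <= reac u.
    by rewrite (le_trans _ (expR_ge1Dx _))// /shifted_pow; lra.
  apply: (@le_trans _ _ (p * shifted_pow u ^+ 2 / 9)).
    have e1 : 2 * eps * (p + 1) <= p / 3 by nra.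
    have := weight_le_sqr u; have := ltW (weight_gt0 u) => s0 s1.
    apply: le_trans (ler_wpM2r s0 e1) _.
    apply: le_trans (ler_wpM2l _ s1) _; first by rewrite divr_ge0 ?ltW.
    by lra.
  apply: (@le_trans _ _ ((shifted_pow u - 2) * (p * (shifted_pow u - 2)))).
    (* p ((g - 2)^2 - (g / 3)^2) >= 0 for g >= 3, factored *)
    have h : 0 <= p * ((shifted_pow u / 3 * 2 - 2) * (shifted_pow u / 3 * 4 - 2)).
      by rewrite mulr_ge0 ?(ltW p_gt0)// mulr_ge0//; lra.
    by lra.
  by apply: ler_pM => //; nra.
have := ler_wpM2l E0 H; rewrite /weight /dweight; lra.
Qed.

(** The difference of the two sides vanishes at a = b and is nondecreasing in
    a, by [reac_weight_mono] and the monotonicity of dweight. *)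
Lemma reac_weight_sub_ge a b eps : 0 < b -> b <= a -> 0 < eps <= 12^-1 ->
  2 * eps * dweight b * (squash a - squash b) <= reac a / weight a - reac b / weight b.
Proof.
move=> b0 ba heps.
pose g s := reac s / weight s - 2 * eps * dweight b * squash s.
pose dg s := (p * s `^ (p - 1) * reac s * weight s - reac s * dweight s) /
  weight s ^+ 2 - 2 * eps * dweight b / weight s.
have dgP (s : R) : 0 < s -> is_derive s 1 g (dg s).
  move=> s0; have dr := is_derive_reac s0; have dS := is_derive_weight s0.
  apply: (is_derive_quot_sub _ dr dS (is_derive_squash s0)).
  exact/lt0r_neq0/weight_gt0.
have [||c] := @MVT_segment _ g dg b a ba.
- by move=> s; rewrite in_itv/= => /andP[bs _]; apply: dgP; exact: lt_trans bs.
- apply: derivable_within_continuous => s; rewrite in_itv/= => /andP[bs _].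
  by apply: (@ex_derive _ _ _ _ _ _ _ (dgP s _)); exact: lt_le_trans bs.
rewrite in_itv/= => /andP[bc ca] gE.
have c0 := lt_le_trans b0 bc.
have dgc : 0 <= dg c.
  have S0 := weight_gt0 c.
  rewrite subr_ge0 ler_pdivlMr ?exprn_gt0// expr2 mulrA divfK ?lt0r_neq0//.
  apply: le_trans (reac_weight_mono c0 heps).
  apply: ler_wpM2r; first exact: ltW.
  apply: ler_wpM2l; last exact: dweight_le (ltW b0) bc.
  by case/andP: heps => e0 _; rewrite mulr_ge0// ltW.
have : 0 <= g a - g b by rewrite gE mulr_ge0// subr_ge0.
clear -p_gt1; rewrite /g.
move: (reac a / _) (reac b / _) (squash a) (squash b) (2 * _ * _) => A B x y k.
by clear -R; rewrite mulrBr; lra.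
Qed.

End Reaction.

(** * Derivative conditions at a local minimum *)

(** The second derivative test along the axis e_i.  The choices G = id, - id
    and plus or minus squash cover all the interior minima that occur. *)
Lemma composite_line_min (R : realType) (n : nat) (U : set 'rV[R]_n)
    (f : 'rV[R]_n -> R) (x : 'rV[R]_n) (i : 'I_n) (G G1 : R -> R) (g2 k : R) :
  open U -> Ck_on 2 U f -> U x ->
  (forall z, U z -> is_derive (f z) 1 G (G1 (f z))) ->
  is_derive (f x) 1 G1 g2 ->
  (\forall z \near x,
     G (f x) + k / 2 * sqnorm x <= G (f z) + k / 2 * sqnorm z) ->
  G1 (f x) * partial i f x + k * x ord0 i = 0 /\
  0 <= g2 * partial i f x ^+ 2 + G1 (f x) * partial i (partial i f) x + k.
Proof.
move=> oU cf Ux dG dG1 xmin; pose e := basis_vec R i.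
have [df d2f] := line_C2 e oU cf Ux.
rewrite hess_form_basis in d2f.
pose g (s : R) := G (f (x + s *: e)) + k / 2 * sqnorm (x + s *: e).
pose g1 (s : R) := G1 (f (x + s *: e)) * grad_form f (x + s *: e) e
  + k * (x ord0 i + s).
have x0 : x + (0 : R) *: e = x by rewrite scale0r addr0.
have near_line (P : set 'rV[R]_n) : (\forall z \near x, P z) ->
    \forall s \near (0 : R), P (x + s *: e).
  have : x + (s : R) *: e @[s --> 0] --> x.
    rewrite -[X in _ --> X]addr0 -(scale0r e).
    apply: cvgD; [exact: cvg_cst | exact: scalel_continuous].
  by move=> + Px => /(_ P Px).
have dq (s : R) : is_derive s 1 (fun s : R => k / 2 * sqnorm (x + s *: e))
    (k * (x ord0 i + s)).
  rewrite (_ : (fun _ => _) = (fun s : R =>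
    k / 2 * (sqnorm x + s * (2 * x ord0 i) + s ^+ 2))); last first.
    by apply/funext => r; rewrite sqnorm_line.
  have d1 := is_deriveM (is_derive_id s 1) (is_derive_cst (2 * x ord0 i) s 1).
  have d2 := is_deriveM (is_derive_id s 1) (is_derive_id s (1 : R)).
  have d3 := is_deriveD (is_deriveD (is_derive_cst (sqnorm x) s 1) d1) d2.
  have d4 := is_deriveM (is_derive_cst (k / 2) s 1) d3.
  by apply: (is_derive_eq d4); rewrite /GRing.scale/=; field.
have dg : \forall s \near (0 : R), is_derive s (1 : R) g (g1 s).
  near=> s.
  have dfs : is_derive s (1 : R) (fun s => f (x + s *: e))
    (grad_form f (x + s *: e) e) by near: s.
  have Us : U (x + s *: e).
    by near: s; apply: near_line; exact: open_nbhs_nbhs.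
  exact: is_deriveD (is_derive1_comp (dG _ Us) dfs) (dq s).
have dg1 : is_derive (0 : R) 1 g1
    (g2 * partial i f x ^+ 2 + G1 (f x) * partial i (partial i f) x + k).
  have df0 := nbhs_singleton df.
  have dG10 : is_derive (f (x + (0 : R) *: e)) 1 G1 g2 by rewrite x0.
  have d1 := is_deriveM (is_derive1_comp dG10 df0) d2f.
  have d2 := is_deriveM (is_derive_cst k (0 : R) 1)
    (is_deriveD (is_derive_cst (x ord0 i) (0 : R) 1) (is_derive_id (0 : R) 1)).
  have d3 := is_deriveD d1 d2.
  apply: (is_derive_eq d3); rewrite /GRing.scale/= x0 !grad_form_basis; ring.
have [] := second_derivative_test dg dg1.
  by rewrite /g x0; exact: (near_line (fun z =>
    G (f x) + k / 2 * sqnorm x <= G (f z) + k / 2 * sqnorm z)).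
by rewrite /g1 x0 grad_form_basis addr0.
Unshelve. all: by end_near. Qed.

(** Along each basis vector e_i, the function f(x + s e_i) - f(y + s e_i Q) of s
    has a minimum at 0; summing the second-order conditions gives the
    difference of the Laplacians, because the rows of Q are orthonormal. *)
Lemma reflected_min_laplacian (R : realType) (n : nat) (U : set 'rV[R]_n)
    (f : 'rV[R]_n -> R) (x y : 'rV[R]_n) (Q : 'M[R]_n) :
  open U -> Ck_on 2 U f -> U x -> U y -> Q^T *m Q = 1%:M ->
  (\forall h \near (0 : 'rV[R]_n), f x - f y <= f (x + h) - f (y + h *m Q)) ->
  laplacian f y <= laplacian f x.
Proof.
move=> oU cf Ux Uy QQ hmin.
rewrite (laplacian_orthonormal f y QQ); apply: ler_sum => i _.
rewrite -hess_form_basis; set e := basis_vec R i; set q := row i Q.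
have eq_ : e *m Q = q by rewrite /q rowE.
have [dfx d2fx] := line_C2 e oU cf Ux; have [dfy d2fy] := line_C2 q oU cf Uy.
have d2 := is_deriveB d2fx d2fy.
have d1 : \forall s \near (0 : R), is_derive s (1 : R)
    (fun s => f (x + s *: e) - f (y + s *: q))
    (grad_form f (x + s *: e) e - grad_form f (y + s *: q) q).
  near=> s.
  have ds1 : is_derive s (1 : R) (fun s => f (x + s *: e))
    (grad_form f (x + s *: e) e) by near: s.
  have ds2 : is_derive s (1 : R) (fun s => f (y + s *: q))
    (grad_form f (y + s *: q) q) by near: s.
  exact: (is_derive_eq (is_deriveB ds1 ds2) erefl).
have [] := second_derivative_test d1 d2; last by rewrite subr_ge0.
have : (s : R) *: e @[s --> 0] --> (0 : 'rV[R]_n).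
  by rewrite -[X in _ --> X](scale0r e); exact: scalel_continuous.
move=> /(_ _ hmin) /=; rewrite nbhs_simpl/=; apply: filterS => s /=.
by rewrite -scalemxAl eq_ !scale0r !addr0.
Unshelve. all: by end_near. Qed.

Lemma min_laplacian_ge (R : realType) (n : nat) (U : set 'rV[R]_n)
    (f : 'rV[R]_n -> R) (x : 'rV[R]_n) (k : R) :
  open U -> Ck_on 2 U f -> U x ->
  (\forall z \near x, f x + k / 2 * sqnorm x <= f z + k / 2 * sqnorm z) ->
  0 <= laplacian f x + n%:R * k.
Proof.
move=> oU cf Ux xmin.
have -> : laplacian f x + n%:R * k =
    \sum_(i < n) (partial i (partial i f) x + k).
  by rewrite big_split/= sumr_const card_ord mulr_natl.
apply: sumr_ge0 => i _.
have dG (z : 'rV[R]_n) : U z -> is_derive (f z) 1 (@id R) (cst 1 (f z)).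
  by move=> _; exact: is_derive_id.
have dG1 := is_derive_cst (1 : R) (f x) (1 : R).
have [_] := composite_line_min i oU cf Ux dG dG1 xmin.
by rewrite mul0r add0r mul1r.
Qed.

Lemma max_laplacian_le (R : realType) (n : nat) (U : set 'rV[R]_n)
    (f : 'rV[R]_n -> R) (x : 'rV[R]_n) :
  open U -> Ck_on 2 U f -> U x -> (\forall z \near x, f z <= f x) ->
  laplacian f x <= 0.
Proof.
move=> oU cf Ux xmax; rewrite -oppr_ge0 -sumrN; apply: sumr_ge0 => i _.
have dG (z : 'rV[R]_n) : U z -> is_derive (f z) 1 (-%R : R -> R) (cst (- 1) (f z)).
  by move=> _; exact: is_deriveNid.
have dG1 := is_derive_cst (- 1 : R) (f x) (1 : R).
have xmin : \forall z \near x, - f x + 0 / 2 * sqnorm x <= - f z + 0 / 2 * sqnorm z.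
  by apply: filterS xmax => z; rewrite !mul0r !addr0 lerN2.
have [_] := composite_line_min i oU cf Ux dG dG1 xmin.
by rewrite mul0r add0r mulN1r addr0.
Qed.

Lemma within_continuousB (R : realType) (X : topologicalType) (A : set X)
    (f g : X -> R) : {within A, continuous f} -> {within A, continuous g} ->
  {within A, continuous (fun x => f x - g x)}.
Proof.
move=> /subspace_continuousP cf /subspace_continuousP cg.
by apply/subspace_continuousP => x Ax; apply: cvgB; [exact: cf|exact: cg].
Qed.

(** * Solutions and the lower barrier *)

Section Solution.
Variables (R : realType) (n : nat) (rad p T : R).
Variables (u0 : 'rV[R]_n -> R) (u : 'rV[R]_n -> R -> R).
Hypotheses (rad_gt0 : 0 < rad) (p_gt1 : 1 < p) (T_gt0 : 0 < T).
Hypothesis sol : classical_solution rad p T u0 u.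
Implicit Types (x y : 'rV[R]_n) (t : R).

Lemma is_derive_time x t : eball rad x -> 0 < t < T ->
  is_derive t 1 (u x) (laplacian (u ^~ t) x + reac p (u x t)).
Proof.
move=> Ex ht; have [d _] := cs_C1 sol Ex ht; split => //.
by rewrite -derive1E (cs_pde sol).
Qed.

(** The map h selects one point of a configuration z: a point itself, or one
    member of a pair. *)
Lemma within_continuous_along (Z : topologicalType) (K : set Z)
    (h : Z -> 'rV[R]_n) (t1 : R) :
  continuous h -> (forall z, K z -> ecball rad (h z)) -> t1 < T ->
  {within K `*` `[0, t1], continuous (fun z : Z * R => u (h z.1) z.2)}.
Proof.
move=> ch Kh t1T.
apply: (@within_continuous_comp _ _ _ _ (ecball rad `*` `[0, T[)
  (fun z : Z * R => (h z.1, z.2)) (fun z : 'rV[R]_n * R => u z.1 z.2)).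
- apply: (@continuous_subspaceT _ _ _ (fun z : Z * R => (h z.1, z.2))) => z.
  have ch1 : h w.1 @[w --> z] --> h z.1.
    by apply: (@continuous_comp _ _ _ fst h); [exact: cvg_fst | exact: ch].
  have ch2 : w.2 @[w --> z] --> z.2 by exact: cvg_snd.
  exact: (cvg_pair ch1 ch2).
- move=> [z t] [/= Kz]; rewrite in_itv/= => /andP[t0 tt1]; split=> /=.
    exact: Kh.
  by rewrite in_itv/= t0 (le_lt_trans tt1).
- exact: (cs_continuous sol).
Qed.

Lemma ecball_eball_or_sphere x : ecball rad x -> eball rad x \/ esphere rad x.
Proof.
by rewrite /ecball/= le_eqVlt => /orP[/eqP|]; [right|left].
Qed.

Lemma eball_ecball x : eball rad x -> ecball rad x.
Proof. exact: ltW. Qed.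

Lemma near_eball x : eball rad x -> \forall z \near x, eball rad z.
Proof. by move=> Ex; apply: open_nbhs_nbhs; split => //; exact: open_eball. Qed.

Lemma ecball0 : ecball rad (0 : 'rV[R]_n).
Proof. by rewrite /ecball/= enorm0 ltW. Qed.

(** The boundary condition is imposed at positive times only; it extends to
    t = 0 by continuity. *)
Lemma sphere_time0 x : esphere rad x -> u x 0 = 0.
Proof.
move=> Sx; have Ex : ecball rad x by rewrite /ecball/= Sx.
apply/eqP; rewrite eq_le (cs_nonneg sol Ex) ?lexx ?T_gt0// andbT leNgt.
apply/negP => u_gt0.
have A0 : (ecball rad `*` `[0, T[) (x, 0 : R).
  by split => //=; rewrite in_itv/= lexx.
have /subspace_continuousP/(_ _ A0)/cvgrPdist_lt/(_ _ u_gt0) := cs_continuous sol.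
rewrite near_withinE => /nbhs_ballP[e /= e0 eP].
pose t := Num.min e T / 2.
have m0 : 0 < Num.min e T by rewrite lt_min e0.
have t0 : 0 < t by rewrite divr_gt0.
have [te tT] : t < e /\ t < T by apply/andP; rewrite -lt_min /t; lra.
have ut : u x t = 0 by apply: (cs_boundary sol Sx); rewrite t0.
have := eP (x, t); rewrite /from_subspace/= ut subr0 gtr0_norm// ltxx => H.
apply: notF; apply: H.
  split => /=; first exact: ballxx.
  by rewrite -ball_normE/= sub0r normrN gtr0_norm.
by split => //=; rewrite in_itv/= (ltW t0).
Qed.

Lemma solution_bounded (t1 : R) : 0 <= t1 < T ->
  exists M, forall x t, ecball rad x -> 0 <= t <= t1 -> u x t <= M.
Proof.
move=> /andP[t10 t1T].
have A0 : (ecball rad `*` `[0, t1]) (0 : 'rV[R]_n, 0 : R).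
  by split; [exact: ecball0 | rewrite /= in_itv/= lexx].
have cu := @within_continuous_along _ (ecball rad) id t1
  (fun x => cvg_id) (fun x Ex => Ex) t1T.
have [z _ zmax] := compact_EVT_max (ex_intro _ _ A0)
  (compact_setX (@compact_ecball R n rad) (@segment_compact _ 0 t1)) cu.
exists (u z.1 z.2) => x t Ex ht; apply: (zmax (x, t)).
by rewrite inE; split => //=; rewrite in_itv.
Qed.

(** The function v(x) = d/2 (rad^2 - |x|^2) satisfies lap v = - n d >= - 1,
    while the reaction term is at least 1, so v is a stationary subsolution. *)
Lemma parabolic_lower_barrier (d : R) : 0 < d -> n%:R * d <= 1 ->
  (forall x, ecball rad x -> d / 2 * (rad ^+ 2 - sqnorm x) <= u x 0) ->
  forall x t, ecball rad x -> 0 <= t < T ->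
    d / 2 * (rad ^+ 2 - sqnorm x) <= u x t.
Proof.
move=> d0 nd init x1 t1 Ex1 /andP[t10 t1T]; rewrite -subr_ge0.
apply: (@parabolic_nonneg R _ (ecball rad)
  (fun x t => u x t - d / 2 * (rad ^+ 2 - sqnorm x)) t1 0) => //.
- exact: compact_ecball.
- apply: within_continuousB.
    exact: (@within_continuous_along _ (ecball rad) id t1 (fun x => cvg_id)).
  apply: (@continuous_subspaceT _ _ _
    (fun z : 'rV[R]_n * R => d / 2 * (rad ^+ 2 - sqnorm z.1))) => z.
  apply: cvgM; first exact: cvg_cst.
  apply: cvgB; first exact: cvg_cst.
  apply: (@continuous_comp _ _ _ fst (@sqnorm R n)); first exact: cvg_fst.
  exact: continuous_sqnorm.
- by move=> z Ez; rewrite subr_ge0 init.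
- move=> x t Ex /andP[t0 tt1] Wneg Wmin.
  have ht : 0 < t < T by rewrite t0 (le_lt_trans tt1).
  have ht' : 0 <= t < T by case/andP: ht => /ltW -> ->.
  have [Bx|Sx] := ecball_eball_or_sphere Ex; last first.
    move: Wneg; rewrite -sqr_enorm Sx subrr mulr0 subr0.
    by rewrite ltNge (cs_nonneg sol Ex ht').
  exists (laplacian (u ^~ t) x + reac p (u x t)).
    have d1 := is_deriveB (is_derive_time Bx ht)
      (is_derive_cst (d / 2 * (rad ^+ 2 - sqnorm x)) t 1).
    by apply: (is_derive_eq d1); rewrite subr0.
  rewrite mul0r.
  have xmin : \forall z \near x,
      u x t + d / 2 * sqnorm x <= u z t + d / 2 * sqnorm z.
    apply: filterS (near_eball Bx) => z /eball_ecball/Wmin; lra.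
  have := min_laplacian_ge (@open_eball R n rad) (cs_C2 sol ht) Bx xmin.
  have := reac_ge1 p (u x t); move: (reac p _) (laplacian _ _) => a b.
  by lra.
- by rewrite t10 lexx.
Qed.

End Solution.

(** * Two-point comparisons *)

(** The final estimate at a negative minimum of the two-point function: X and
    Y are the squared norms of the two points, lx and ly the Laplacians, N the
    contribution n eps common to both points.  The last hypothesis makes the
    factor of dM negative, so dM may replace the smaller db; the point of dM
    is that it does not depend on the minimum. *)
Lemma squash_gap_rate
    (R : realType) (e da db dM X Y N lx ly fa fb ga gb sa sb : R) :
  0 <= e -> 0 <= X -> db <= da -> db <= dM ->
  e ^+ 2 * da * X - N <= lx / sa -> ly / sb <= e ^+ 2 * db * Y - N ->
  2 * e * db * (ga - gb) <= fa / sa - fb / sb ->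
  ga - gb - e / 2 * (Y - X) < 0 ->
  2 * e * dM * (ga - gb - e / 2 * (Y - X)) <=
    sa^-1 * (lx + fa) - sb^-1 * (ly + fb).
Proof.
move=> e0 X0 ba bM hx hy key W0.
have h1 : 0 <= e ^+ 2 * (da - db) * X.
  by rewrite !mulr_ge0 ?subr_ge0 ?sqr_ge0.
have h2 : 2 * e * dM * (ga - gb - e / 2 * (Y - X)) <=
          2 * e * db * (ga - gb - e / 2 * (Y - X)).
  apply: ler_wnM2r; first exact: ltW.
  by apply: ler_wpM2l => //; rewrite mulr_ge0.
by apply: (le_trans h2); lra.
Qed.

Lemma pair_min_fst (R : realType) (a b c k X Y Z : R) :
  a - b - k / 2 * (Y - X) <= c - b - k / 2 * (Y - Z) ->
  a + k / 2 * X <= c + k / 2 * Z.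
Proof. by move=> h; lra. Qed.

Lemma pair_min_snd (R : realType) (a b c k X Y Z : R) :
  a - b - k / 2 * (Y - X) <= a - c - k / 2 * (Z - X) ->
  - b + - k / 2 * Y <= - c + - k / 2 * Z.
Proof. by move=> h; lra. Qed.

Section Comparison.
Variables (R : realType) (n : nat) (rad p T : R).
Variables (u0 : 'rV[R]_n -> R) (u : 'rV[R]_n -> R -> R).
Hypotheses (rad_gt0 : 0 < rad) (p_gt1 : 1 < p) (T_gt0 : 0 < T).
Hypothesis sol : classical_solution rad p T u0 u.
Implicit Types (x y : 'rV[R]_n) (t : R).

Lemma continuous_pair_fst :
  continuous (fst : 'rV[R]_n * 'rV[R]_n -> 'rV[R]_n).
Proof. by move=> z; exact: cvg_fst. Qed.

Lemma continuous_pair_snd :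
  continuous (snd : 'rV[R]_n * 'rV[R]_n -> 'rV[R]_n).
Proof. by move=> z; exact: cvg_snd. Qed.

Lemma ordered_pairs_fst (z : 'rV[R]_n * 'rV[R]_n) :
  ordered_pairs rad z -> ecball rad z.1.
Proof. by case=> z12 z2; exact: le_trans z12 z2. Qed.

Lemma ordered_pairs_snd (z : 'rV[R]_n * 'rV[R]_n) :
  ordered_pairs rad z -> ecball rad z.2.
Proof. by case. Qed.

Lemma near_enorm_lt x (r : R) : enorm x < r -> \forall z \near x, enorm z < r.
Proof. exact: (@near_eball R n r). Qed.

Lemma near_enorm_gt x (r : R) : r < enorm x -> \forall z \near x, r < enorm z.
Proof.
move=> rx; have : \forall s \near enorm x, r < s.
  by apply: open_nbhs_nbhs; split => //; exact: open_gt.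
by move=> /(@continuous_enorm R n x).
Qed.

(** At a negative minimum of u(x,t) - u(y,t) over the pairs |x| <= |y| <= rad,
    the Laplacian at y is at most that at x.  If |x| < |y|, each point can be
    moved alone; if |x| = |y|, the two are moved together by a reflection.
    The difference of the reaction terms is controlled by a Lipschitz constant. *)
Lemma radially_nonincreasing :
  (forall x y, enorm x <= enorm y -> enorm y <= rad -> u y 0 <= u x 0) ->
  forall x y t, enorm x <= enorm y -> enorm y <= rad -> 0 <= t < T ->
    u y t <= u x t.
Proof.
move=> init x1 y1 t1 xy1 y1r /andP[t10 t1T]; rewrite -subr_ge0.
have [|M uM] := solution_bounded rad_gt0 sol (t1 := t1); first by rewrite t10.
have [L L0 fL] := reac_lipschitz p_gt1 M.
apply: (@parabolic_nonneg R _ (@ordered_pairs R n rad)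
  (fun z t => u z.1 t - u z.2 t) t1 L _ _ _ _ (x1, y1) t1) => //.
- exact: compact_ordered_pairs.
- apply: within_continuousB.
    exact: (within_continuous_along sol continuous_pair_fst ordered_pairs_fst).
  exact: (within_continuous_along sol continuous_pair_snd ordered_pairs_snd).
- by move=> z [z12 z2]; rewrite subr_ge0 init.
- move=> [x y] t Kxy /andP[t0 tt1] /=; rewrite subr_lt0 => uxy Wmin.
  have ht : 0 < t < T by rewrite t0 (le_lt_trans tt1).
  have ht' : 0 <= t < T by case/andP: ht => /ltW -> ->.
  have htt : 0 <= t <= t1 by rewrite (ltW t0).
  have Ex : ecball rad x := ordered_pairs_fst Kxy.
  have Ey : ecball rad y := ordered_pairs_snd Kxy.
  have [xy _] : enorm x <= enorm y /\ enorm y <= rad := Kxy.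
  have [By|Sy] := ecball_eball_or_sphere Ey; last first.
    by move: uxy; rewrite (cs_boundary sol Sy ht) ltNge (cs_nonneg sol Ex ht').
  have Bx : eball rad x by exact: le_lt_trans xy By.
  have oB := @open_eball R n rad; have C2 := cs_C2 sol ht.
  have lap : laplacian (u ^~ t) y <= laplacian (u ^~ t) x.
    move: xy; rewrite le_eqVlt => /orP[/eqP xy|xy].
      have xNy : x != y by apply: contraTneq uxy => ->; rewrite ltxx.
      have [Q QQ xQ] := householder xy xNy.
      apply: (reflected_min_laplacian oB C2 Bx By QQ).
      have : \forall h \near (0 : 'rV[R]_n), eball rad (x + h).
        have xh : x + h @[h --> (0 : 'rV[R]_n)] --> x.
          rewrite -[X in _ --> X]addr0.
          apply: (@cvgD _ _ _ (nbhs (0 : 'rV[R]_n)) _ (cst x) id x 0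
            (cvg_cst x) cvg_id).
        by have := xh _ (near_eball Bx).
      apply: filterS => h Bh.
      have yh : y + h *m Q = (x + h) *m Q by rewrite mulmxDl xQ.
      apply: (Wmin (x + h, y + h *m Q)); split => /=; rewrite yh enorm_isometry//.
      exact: ltW.
    apply: (@le_trans _ _ 0).
      apply: (max_laplacian_le oB C2 By).
      apply: filterS2 (near_eball By) (near_enorm_gt xy) => z Bz xz.
      have : ordered_pairs rad (x, z) by split; exact: ltW.
      by move=> /Wmin/=; rewrite lerD2l lerN2.
    have := @min_laplacian_ge R n _ (u ^~ t) x 0 oB C2 Bx.
    rewrite mulr0 addr0; apply.
    apply: filterS (near_enorm_lt xy) => z zy.
    have : ordered_pairs rad (z, y) by split; exact: ltW.
    by move=> /Wmin/=; rewrite !mul0r !addr0 lerD2r.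
  exists (laplacian (u ^~ t) x + reac p (u x t) -
          (laplacian (u ^~ t) y + reac p (u y t))).
    have d1 := is_deriveB (is_derive_time sol Bx ht) (is_derive_time sol By ht).
    exact: (is_derive_eq d1 erefl).
  have := fL _ _ (cs_nonneg sol Ex ht') (ltW uxy) (uM _ _ Ey htt).
  rewrite -[u x t - _]opprB mulrN; move: lap (reac p _) (reac p _).
  move: (laplacian _ _) (laplacian _ _) (L * _) => c d m cd a b.
  by move=> h; lra.
- by rewrite t10 lexx.
Qed.

(** The inequality (1).  Monotonicity excludes that a negative minimum lies
    on |x| = |y|, and the hypothesis from the barrier excludes |y| = rad. *)
Lemma squash_gap (eps : R) : 0 < eps <= 12^-1 ->
  (forall x t, eball rad x -> 0 < t < T -> 0 < u x t) ->
  (forall x y t, enorm x <= enorm y -> enorm y <= rad -> 0 <= t < T ->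
    u y t <= u x t) ->
  (forall x y, enorm x <= enorm y -> enorm y <= rad ->
    eps / 2 * (sqnorm y - sqnorm x) <= squash p (u x 0) - squash p (u y 0)) ->
  (forall x t, ecball rad x -> 0 < t < T ->
    eps / 2 * (rad ^+ 2 - sqnorm x) <= squash p (u x t)) ->
  forall x y t, enorm x <= enorm y -> enorm y <= rad -> 0 <= t < T ->
    eps / 2 * (sqnorm y - sqnorm x) <= squash p (u x t) - squash p (u y t).
Proof.
move=> heps upos mono init bdry x1 y1 t1 xy1 y1r /andP[t10 t1T].
rewrite -subr_ge0.
have [|M uM] := solution_bounded rad_gt0 sol (t1 := t1); first by rewrite t10.
apply: (@parabolic_nonneg R _ (@ordered_pairs R n rad)
  (fun z t => squash p (u z.1 t) - squash p (u z.2 t)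
     - eps / 2 * (sqnorm z.2 - sqnorm z.1)) t1 (2 * eps * dweight p M)
   _ _ _ _ (x1, y1) t1) => //.
- exact: compact_ordered_pairs.
- have csquash (h : 'rV[R]_n * 'rV[R]_n -> 'rV[R]_n) : continuous h ->
      (forall z, ordered_pairs rad z -> ecball rad (h z)) ->
      {within ordered_pairs rad `*` `[0, t1],
        continuous (fun z : 'rV[R]_n * 'rV[R]_n * R => squash p (u (h z.1) z.2))}.
    move=> ch Kh; have c1 := within_continuous_along sol ch Kh t1T.
    have u_ge0 (z : 'rV[R]_n * 'rV[R]_n * R) :
        (ordered_pairs rad `*` `[0, t1]) z ->
        `[0, +oo[%classic (u (h z.1) z.2).
      move: z => [z t] [/= Kz]; rewrite !in_itv/= andbT => /andP[t0 tt1].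
      by rewrite (cs_nonneg sol (Kh _ Kz)) ?t0 ?(le_lt_trans tt1).
    exact: (within_continuous_comp c1 u_ge0 (continuous_squash p_gt1)).
  apply: within_continuousB.
    apply: within_continuousB.
      exact: (csquash _ continuous_pair_fst ordered_pairs_fst).
    exact: (csquash _ continuous_pair_snd ordered_pairs_snd).
  apply: (@continuous_subspaceT _ _ _ (fun z : 'rV[R]_n * 'rV[R]_n * R =>
    eps / 2 * (sqnorm z.1.2 - sqnorm z.1.1))) => z.
  apply: cvgM; first exact: cvg_cst.
  apply: cvgB.
    apply: (@continuous_comp _ _ _ (fun z : 'rV[R]_n * 'rV[R]_n * R => z.1.2)
      (@sqnorm R n)); last exact: continuous_sqnorm.
    apply: (@continuous_comp _ _ _ fst snd); first exact: cvg_fst.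
    exact: cvg_snd.
  apply: (@continuous_comp _ _ _ (fun z : 'rV[R]_n * 'rV[R]_n * R => z.1.1)
    (@sqnorm R n)); last exact: continuous_sqnorm.
  by apply: (@continuous_comp _ _ _ fst fst); exact: cvg_fst.
- by move=> z [z12 z2]; rewrite subr_ge0 init.
- move=> [x y] t Kxy /andP[t0 tt1] /= Wneg Wmin.
  have ht : 0 < t < T by rewrite t0 (le_lt_trans tt1).
  have ht' : 0 <= t < T by case/andP: ht => /ltW -> ->.
  have htt : 0 <= t <= t1 by rewrite (ltW t0).
  have Ex : ecball rad x := ordered_pairs_fst Kxy.
  have Ey : ecball rad y := ordered_pairs_snd Kxy.
  have [xy yr] : enorm x <= enorm y /\ enorm y <= rad := Kxy.
  have [By|Sy] := ecball_eball_or_sphere Ey; last first.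
    move: Wneg; rewrite (cs_boundary sol Sy ht) squash0 subr0 subr_lt0 ltNge.
    by rewrite -(sqr_enorm y) Sy bdry.
  have {}xy : enorm x < enorm y.
    rewrite lt_neqAle xy andbT; apply: contraTneq Wneg => xy'.
    have -> : u x t = u y t.
      by apply/eqP; rewrite eq_le !mono// xy'.
    by rewrite -!sqr_enorm xy' !subrr mulr0 subrr ltxx.
  have Bx : eball rad x by exact: lt_trans xy By.
  have oB := @open_eball R n rad; have C2 := cs_C2 sol ht.
  have a0 := upos _ _ Bx ht; have b0 := upos _ _ By ht.
  have ba := mono _ _ _ (ltW xy) yr ht'.
  have S0 (v : R) := lt0r_neq0 (weight_gt0 p v).
  pose a := u x t; pose b := u y t.
  have minx : \forall z \near x, squash p (u x t) + eps / 2 * sqnorm x <=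
                                 squash p (u z t) + eps / 2 * sqnorm z.
    apply: filterS (near_enorm_lt xy) => z zy.
    have /Wmin/= : ordered_pairs rad (z, y) by split; exact: ltW.
    exact: pair_min_fst.
  have miny : \forall z \near y, - squash p (u y t) + - eps / 2 * sqnorm y <=
                                 - squash p (u z t) + - eps / 2 * sqnorm z.
    apply: filterS2 (near_eball By) (near_enorm_gt xy) => z Bz xz.
    have /Wmin/= : ordered_pairs rad (x, z) by split; exact: ltW.
    exact: pair_min_snd.
  have Sb := weight_gt0 p b; have Sa := weight_gt0 p a.
  have dGa := is_deriveV (S0 a) (is_derive_weight p_gt1 a0).
  have dGb : is_derive b 1 (fun v => - (weight p v)^-1)
      (weight p b ^- 2 * dweight p b).
    apply: (is_derive_eq (is_deriveN (is_deriveV (S0 b)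
      (is_derive_weight p_gt1 b0)))).
    by rewrite /GRing.scale/= mulNr opprK.
  have lapx : eps ^+ 2 * dweight p a * sqnorm x - n%:R * eps <=
      laplacian (u ^~ t) x / weight p a.
    have -> : eps ^+ 2 * dweight p a * sqnorm x - n%:R * eps =
        \sum_(i < n) (eps ^+ 2 * dweight p a * x ord0 i ^+ 2 - eps).
      by rewrite sumrB sumr_const card_ord mulr_natl -mulr_sumr.
    rewrite mulr_suml; apply: ler_sum => i _.
    have dG (z : 'rV[R]_n) : eball rad z ->
        is_derive (u z t) 1 (squash p) (weight p (u z t))^-1.
      by move=> Bz; exact: is_derive_squash (upos _ _ Bz ht).
    have [] := composite_line_min i oB C2 Bx dG dGa minx.
    rewrite -/a => grad; rewrite /GRing.scale/= mulrAC.
    (* the first-order condition makes the gradient term a multiple of x_i^2 *)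
    have -> : partial i (u ^~ t) x = - (eps * x ord0 i) * weight p a.
      by move/eqP: grad; rewrite addr_eq0 => /eqP <-; field; exact: S0.
    move: (partial i (partial i _) x) => H.
    rewrite (_ : - _ * _ * _ + _ + _ =
      H / weight p a - (eps ^+ 2 * dweight p a * x ord0 i ^+ 2 - eps)).
      by rewrite subr_ge0.
    by field; exact: S0.
  have lapy : laplacian (u ^~ t) y / weight p b <=
      eps ^+ 2 * dweight p b * sqnorm y - n%:R * eps.
    have -> : eps ^+ 2 * dweight p b * sqnorm y - n%:R * eps =
        \sum_(i < n) (eps ^+ 2 * dweight p b * y ord0 i ^+ 2 - eps).
      by rewrite sumrB sumr_const card_ord mulr_natl -mulr_sumr.
    rewrite mulr_suml; apply: ler_sum => i _.
    have dG (z : 'rV[R]_n) : eball rad z -> is_derive (u z t) 1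
        (fun v => - squash p v) (- (weight p (u z t))^-1).
      move=> Bz; have d1 := is_deriveN (is_derive_squash p_gt1 (upos _ _ Bz ht)).
      exact: (is_derive_eq d1 erefl).
    have [] := composite_line_min i oB C2 By dG dGb miny.
    rewrite -/b => grad; rewrite /GRing.scale/= mulrAC.
    have -> : partial i (u ^~ t) y = - (eps * y ord0 i) * weight p b.
      move/eqP: grad; rewrite !mulNr -opprD oppr_eq0 addr_eq0 => /eqP E.
      by rewrite -mulNr -E; field; exact: S0.
    move: (partial i (partial i _) y) => H.
    rewrite -[H / _ <= _]subr_ge0 => /le_trans; apply; rewrite /= le_eqVlt.
    by apply/orP; left; apply/eqP; field; exact: S0.
  exists ((weight p a)^-1 * (laplacian (u ^~ t) x + reac p a) -
          (weight p b)^-1 * (laplacian (u ^~ t) y + reac p b)).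
    have dx := is_derive1_comp (is_derive_squash p_gt1 a0) (is_derive_time sol Bx ht).
    have dy := is_derive1_comp (is_derive_squash p_gt1 b0) (is_derive_time sol By ht).
    have d1 := is_deriveB (is_deriveB dx dy)
      (is_derive_cst (eps / 2 * (sqnorm y - sqnorm x)) t 1).
    by apply: (is_derive_eq d1); rewrite subr0.
  case/andP: (heps) => /ltW eps0 _.
  apply: (squash_gap_rate eps0 (sqnorm_ge0 x) _ _ lapx lapy _ Wneg).
  - exact: (dweight_le p_gt1 (ltW b0) ba).
  - exact: (dweight_le p_gt1 (ltW b0) (uM _ _ Ey htt)).
  - exact: (reac_weight_sub_ge p_gt1 b0 ba heps).
- by rewrite t10 lexx.
Qed.

End Comparison.

(** * The initial datum *)

(** The profile phi is known only on [0, rad], while psi is the restriction of a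
    smooth extension of the datum to a ray, hence derivable on both sides of
    each point of [0, rad]. *)
Section InitialSlope.
Variables (R : realType) (rad delta : R) (phi psi : R -> R).
Hypotheses
  (psi_derivable : forall s : R, s \in `[0, rad] -> derivable psi s 1)
  (phi_psi : forall s : R, s \in `[0, rad] -> phi s = psi s).

Lemma derive_within_oo (r : R) : r \in `]0, rad[ ->
  derive_within `[0, rad] phi r = 'D_1 psi r.
Proof.
move=> r_in; have r_in' := subset_itv_oo_cc r_in; rewrite /derive_within.
have near_in : \forall s \near r, s \in `[0, rad].
  by apply: filterS (near_in_itvoo r_in) => s; exact: subset_itv_oo_cc.
have -> : within [set` `[0, rad]] r^' = r^'.
  apply/seteqP; split=> A /=; rewrite /within/=.
    by apply: filterS2 (nbhs_dnbhs near_in) => s s_in; exact.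
  by apply: filterS => s As _.
apply: cvg_lim => //; apply/cvgrPdist_le => e e0.
have := is_derive_growth_cvg (derivableP (psi_derivable r_in')).
move=> /cvgrPdist_le/(_ _ e0); rewrite near_withinE => /nbhs_ballP[d /= d0 dP].
rewrite near_withinE; near=> s => s_neq_r.
have s_in : s \in `[0, rad] by near: s.
have sr : `|s - r| < d.
  by near: s; apply/nbhs_ballP; exists d => //= s; rewrite -ball_normE/= distrC.
have := dP (s - r); rewrite -ball_normE/= sub0r normrN subr_eq0 => /(_ sr s_neq_r).
by rewrite [_%:A]mulr1 subrK -!phi_psi// -[_ *: _]/(_ * _) mulrC.
Unshelve. all: by end_near. Qed.

(** By the hypothesis, psi + delta/2 s^2 is nonincreasing. *)
Lemma slope_integrated :
  (forall r : R, 0 < r -> r <= rad ->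
     derive_within `[0, rad] phi r <= - delta * r) ->
  forall a b : R, 0 <= a -> a <= b -> b <= rad ->
    delta / 2 * (b ^+ 2 - a ^+ 2) <= phi a - phi b.
Proof.
move=> phi_slope a b a0 ab brad.
have sub (s : R) : s \in `[a, b] -> s \in `[0, rad].
  by rewrite !in_itv/= => /andP[? ?]; rewrite (le_trans a0)//= (le_trans _ brad).
have dp (s : R) : s \in `]a, b[ -> is_derive s 1
    (fun s => psi s + delta / 2 * s ^+ 2) ('D_1 psi s + delta * s).
  move=> s_ab; have d1 := derivableP (psi_derivable (sub _ (subset_itv_oo_cc s_ab))).
  have d2 := is_deriveM (is_derive_cst (delta / 2) s 1)
    (is_deriveM (is_derive_id s 1) (is_derive_id s (1 : R))).
  apply: (is_derive_eq (is_deriveD d1 d2)).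
  by rewrite /GRing.scale/=; field.
have cp : {within `[a, b], continuous (fun s => psi s + delta / 2 * s ^+ 2)}.
  apply: derivable_within_continuous => s s_ab; apply: derivableD.
    exact/psi_derivable/sub.
  apply: derivableM; first exact: derivable_cst.
  exact: exprn_derivable.
have pa : phi a = psi a by apply/phi_psi/sub; rewrite in_itv/= lexx.
have pb : phi b = psi b by apply/phi_psi/sub; rewrite in_itv/= lexx ab.
have := ab; rewrite le_eqVlt => /orP[/eqP->|{}ab]; first by rewrite !subrr mulr0.
have [c] := MVT ab dp cp; rewrite in_itv/= => /andP[ac cb] E.
have c0 := le_lt_trans a0 ac; have cr := lt_le_trans cb brad.
have := phi_slope c c0 (ltW cr); rewrite derive_within_oo ?in_itv/= ?c0// => Dc.
have : ('D_1 psi c + delta * c) * (b - a) <= 0.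
  by rewrite pmulr_lle0 ?subr_gt0//; lra.
by rewrite -E pa pb; lra.
Qed.

End InitialSlope.

(** * Blow-up points *)

Lemma blowup_point0 (R : realType) (n : nat) (rad T : R)
    (u : 'rV[R]_n -> R -> R) :
  0 < rad -> 0 < T ->
  (forall x t, ecball rad x -> 0 <= t < T -> u x t <= u 0 t) ->
  blows_up_at rad T u -> blowup_point rad T u 0.
Proof.
move=> rad0 T0 umax blow; have E0 : ecball rad (0 : 'rV[R]_n) := ecball0 n rad0.
split => //.
have u0_oo : u 0 t @[t --> T^'-] --> +oo.
  apply: ger_cvgy blow; rewrite near_withinE.
  apply: filterS (near_in_itvoo (a := 0) (b := T + 1) _); last first.
    by rewrite in_itv/= T0/= ltrDl ltr01.
  move=> t; rewrite in_itv/= => /andP[t0 _] tT; apply: ge_sup.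
    by exists (u 0 t), 0.
  by move=> _ [x Ex <-]; apply: umax => //; rewrite (ltW t0).
pose t_ k : R := T - T / 2 * harmonic k.
have h0 k : 0 < (harmonic k : R) by rewrite invr_gt0 ltr0n.
have h1 k : (harmonic k : R) <= 1 by rewrite invf_le1 ?ltr0n// ler1n.
have tT k : t_ k < T by rewrite gtrBl mulr_gt0 ?divr_gt0.
have t0 k : 0 < t_ k by have := h1 k; rewrite /t_; nra.
have t_cvg : t_ k @[k --> \oo] --> T.
  rewrite -[X in _ --> X]subr0 -(mulr0 (T / 2)).
  apply: cvgB; first exact: cvg_cst.
  by apply: cvgM; [exact: cvg_cst | exact: cvg_harmonic].
exists (fun=> 0), t_; split => //.
- by move=> k; rewrite t0 tT.
- exact: cvg_cst.
- apply: cvg_comp u0_oo => A; rewrite /at_left /within/= => TA.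
  have [N _ NA] := t_cvg _ TA; exists N => // k Nk.
  exact: NA k Nk (tT k).
Qed.

Lemma half_le_of_dist (R : realType) (a b : R) : `|a - b| < a / 2 -> a / 2 <= b.
Proof. by rewrite ltr_norml => /andP[_ h]; lra. Qed.

Lemma sup_gap_absurd (R : realType) (S a b c e X Y : R) : 0 < e ->
  X / 2 <= Y -> S - e / 4 * X < a -> a <= b -> c <= S ->
  e / 2 * Y <= c - b -> False.
Proof.
move=> e0 XY Sa ab cS gap.
have : e / 2 * (X / 2) <= e / 2 * Y by apply: ler_wpM2l => //; rewrite divr_ge0 ?ltW.
by move=> h; lra.
Qed.

(** Near a blow-up point the values of squash come arbitrarily close to their
    supremum, whereas at x they stay below it by eps/2 |x|^2. *)
Lemma blowup_point_eq0 (R : realType) (n : nat) (rad p T eps : R)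
    (u : 'rV[R]_n -> R -> R) (x0 : 'rV[R]_n) :
  1 < p -> 0 < rad -> 0 < eps ->
  (forall x t, ecball rad x -> 0 < t < T -> 0 <= u x t) ->
  (forall x t, ecball rad x -> 0 < t < T ->
     eps / 2 * sqnorm x <= squash p (u 0 t) - squash p (u x t)) ->
  blowup_point rad T u x0 -> x0 = 0.
Proof.
move=> p1 rad0 eps0 u_ge0 gap [_ [x_ [t_ [xt x_cvg _ u_oo]]]].
apply/eqP/negP => x0_neq0.
have sx0 : 0 < sqnorm x0.
  rewrite lt_neqAle sqnorm_ge0 andbT eq_sym -sqr_enorm sqrf_eq0.
  by apply/negP => /eqP/enorm_eq0 x00; apply: x0_neq0; rewrite x00.
pose E := [set squash p v | v in [set v : R | 0 <= v]].
have supE : has_sup E.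
  split; first by exists (squash p 0), 0 => //=.
  by exists 1 => _ [v /= v0 <-]; exact: ltW (squash_lt1 p1 v0).
have eta0 : 0 < eps / 4 * sqnorm x0 by rewrite mulr_gt0 ?divr_gt0.
have [_ [A /= A0 <-] SA] := sup_adherent eta0 supE.
have sq_cvg : sqnorm (x_ k) @[k --> \oo] --> sqnorm x0.
  exact: (cvg_comp _ _ x_cvg (@continuous_sqnorm R n x0)).
have half : 0 < sqnorm x0 / 2 by rewrite divr_gt0.
have /cvgrPdist_lt/(_ _ half) near_sq := sq_cvg.
have near_u : \forall k \near \oo, A <= u (x_ k) (t_ k).
  by move/cvgryPge : u_oo; exact.
have [N _ NP] : \forall k \near \oo,
    `|sqnorm x0 - sqnorm (x_ k)| < sqnorm x0 / 2 /\ A <= u (x_ k) (t_ k).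
  by apply: filterS2 near_sq near_u => k; split.
have [sqN uN] := NP N (leqnn N).
have [Ex ht] := xt N.
have E0 : ecball rad (0 : 'rV[R]_n) := ecball0 n rad0.
have ratA : squash p A <= squash p (u (x_ N) (t_ N)) by exact: squash_le.
have ratS : squash p (u 0 (t_ N)) <= sup E.
  by apply: ub_le_sup; [case: supE | exists (u 0 (t_ N)) => //=; exact: u_ge0].
have gapN := gap _ _ Ex ht.
exact: (sup_gap_absurd eps0 (half_le_of_dist sqN) SA ratA ratS gapN).
Qed.

(** * The theorem *)

Lemma scaled_bound (R : realType) (e a X S S' : R) :
  0 <= e -> 0 <= X -> 0 < S' -> S <= S' -> e <= a / S' ->
  e / 2 * X * S <= a / 2 * X.
Proof.
move=> e0 X0 S'0 SS' ea; have eS : e * S <= a.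
  by rewrite (le_trans (ler_wpM2l e0 SS'))// -ler_pdivlMr.
have -> : e / 2 * X * S = e * S * (X / 2) by ring.
have -> : a / 2 * X = a * (X / 2) by ring.
by apply: ler_wpM2r => //; rewrite divr_ge0.
Qed.

Lemma small_constant (R : realType) (a b : R) : 0 < a -> 0 < b ->
  exists e : R, [/\ 0 < e <= 12^-1, e <= a & e <= b].
Proof.
move=> a0 b0; exists (Num.min 12^-1 (Num.min a b)).
by rewrite !lt_min !ge_min a0 b0 !lexx !orbT invr_gt0 ltr0n.
Qed.

Unset Implicit Arguments.

(* [phi] is the radial profile of [u0]: u0(x) = phi(|x|). *)
Theorem theorem2p3 (R : realType) (n : nat) (rad p T delta : R)
    (u0 : 'rV[R]_n -> R) (phi : R -> R) (u : 'rV[R]_n -> R -> R)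
    (n_ge1 : (1 <= n)%N) (rad_gt0 : 0 < rad) (p_gt1 : 1 < p) (T_gt0 : 0 < T)
    (u0_smooth : smooth_on (ecball rad) u0)
    (u0_neq0 : exists2 x, ecball rad x & u0 x != 0)
    (u0_ge0 : forall x, ecball rad x -> 0 <= u0 x)
    (u0_radial : forall x, ecball rad x -> u0 x = phi (enorm x))
    (u0_nonincreasing :
      forall r s : R, 0 <= r -> r <= s -> s <= rad -> phi s <= phi r)
    (u0_boundary : forall x, esphere rad x -> u0 x = 0)
    (u0_subsolution : forall x, eball rad x ->
      0 <= laplacian u0 x + expR (u0 x `^ p))
    (u_solution : classical_solution rad p T u0 u)
    (u_blows_up : blows_up_at rad T u)
    (delta_gt0 : 0 < delta)
    (u0_slope : forall r : R, 0 < r -> r <= rad ->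
      derive_within `[0, rad] phi r <= - delta * r) :
  forall x0 : 'rV[R]_n, blowup_point rad T u x0 <-> x0 = 0.
Proof.
(* the datum is read along the ray spanned by e *)
pose e := basis_vec R (Ordinal n_ge1).
have e_norm (r : R) : 0 <= r -> enorm (r *: e) = r.
  by move=> r0; rewrite enorm_scale_basis ger0_norm.
have phi_drop (a b : R) : 0 <= a -> a <= b -> b <= rad ->
    delta / 2 * (b ^+ 2 - a ^+ 2) <= phi a - phi b.
  have [U [g [oU BU gu0 Ug]]] := u0_smooth.
  have ray (s : R) : s \in `[0, rad] -> ecball rad (s *: e).
    by rewrite in_itv/= => /andP[s0 sr]; rewrite /ecball/= e_norm.
  apply: (@slope_integrated _ _ _ phi (fun s => g (0 + s *: e))) => // s s_in.
    have Us : U (0 + s *: e) by rewrite add0r; exact/BU/ray.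
    have [_ /(_ isT) dg] := Ug 1%N [::] isT _ Us.
    exact: @ex_derive _ _ _ _ _ _ _ (is_derive_line (derivableP (dg _))).
  rewrite add0r gu0; last exact: ray.
  rewrite u0_radial; last exact: ray.
  by move: s_in; rewrite in_itv/= => /andP[s0 _]; rewrite e_norm.
have init (x : 'rV[R]_n) : ecball rad x -> u x 0 = phi (enorm x).
  move=> Ex; rewrite -u0_radial//; have [Bx|Sx] := ecball_eball_or_sphere Ex.
    exact: (cs_initial u_solution).
  by rewrite (sphere_time0 T_gt0 u_solution Sx) u0_boundary.
have u_ge0 := cs_nonneg u_solution.
have init_drop (x y : 'rV[R]_n) : enorm x <= enorm y -> enorm y <= rad ->
    delta / 2 * (sqnorm y - sqnorm x) <= u x 0 - u y 0.
  move=> xy yr; rewrite !init//; last exact: le_trans xy yr.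
  by rewrite -!sqr_enorm phi_drop// enorm_ge0.
have mono : forall x y t, enorm x <= enorm y -> enorm y <= rad ->
    0 <= t < T -> u y t <= u x t.
  apply: (radially_nonincreasing rad_gt0 p_gt1 u_solution) => x y xy yr.
  rewrite !init//; last exact: le_trans xy yr.
  by apply: u0_nonincreasing => //; exact: enorm_ge0.
have n_gt0 : 0 < n%:R :> R by rewrite ltr0n.
pose d := Num.min delta n%:R^-1.
have d_gt0 : 0 < d by rewrite lt_min delta_gt0 invr_gt0.
have nd : n%:R * d <= 1.
  by rewrite -ler_pdivlMl// mulr1 ge_min lexx orbT.
have d_delta : d <= delta by rewrite ge_min lexx.
have sq_rad (x : 'rV[R]_n) : ecball rad x -> 0 <= rad ^+ 2 - sqnorm x.
  by move=> Ex; rewrite subr_ge0 -sqr_enorm ler_sqr// nnegrE ?enorm_ge0// ltW.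
have re_rad := e_norm _ (ltW rad_gt0).
have barrier : forall x t, ecball rad x -> 0 <= t < T ->
    d / 2 * (rad ^+ 2 - sqnorm x) <= u x t.
  apply: (parabolic_lower_barrier u_solution d_gt0 nd) => x Ex.
  have : delta / 2 * (sqnorm (rad *: e) - sqnorm x) <= u x 0 - u (rad *: e) 0.
    by apply: init_drop; rewrite re_rad.
  rewrite (sphere_time0 T_gt0 u_solution re_rad) subr0 -sqr_enorm re_rad.
  apply: le_trans; apply: ler_wpM2r; first exact: sq_rad.
  by rewrite ler_pM2r ?invr_gt0.
have upos (x : 'rV[R]_n) (t : R) : eball rad x -> 0 < t < T -> 0 < u x t.
  move=> Bx /andP[t0 tT]; apply: lt_le_trans (barrier x t (eball_ecball Bx) _).
    rewrite mulr_gt0 ?divr_gt0// subr_gt0 -sqr_enorm ltr_sqr ?nnegrE ?enorm_ge0//.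
    exact: ltW.
  by rewrite (ltW t0).
pose m0 := phi 0; pose m1 := d / 2 * rad ^+ 2.
have [eps [heps eps0 eps1]] := small_constant
  (divr_gt0 delta_gt0 (weight_gt0 p m0)) (divr_gt0 d_gt0 (weight_gt0 p m1)).
have [eps_gt0 _] := andP heps.
have gap : forall x y t, enorm x <= enorm y -> enorm y <= rad -> 0 <= t < T ->
    eps / 2 * (sqnorm y - sqnorm x) <= squash p (u x t) - squash p (u y t).
  apply: (squash_gap rad_gt0 p_gt1 u_solution heps upos mono).
  - move=> x y xy yr; have Ex : ecball rad x by exact: le_trans xy yr.
    have h0 : 0 <= (0 : R) < T by rewrite T_gt0 andbT.
    have ux0 := u_ge0 x 0 Ex h0; have uy0 := u_ge0 y 0 yr h0.
    apply: le_trans (squash_sub_ge p_gt1 uy0 (mono _ _ _ xy yr h0)).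
    have ux_m0 : u x 0 <= m0.
      by rewrite init//; apply: u0_nonincreasing => //; exact: enorm_ge0.
    rewrite ler_pdivlMr ?weight_gt0//; apply: le_trans (init_drop x y xy yr).
    have sxy : 0 <= sqnorm y - sqnorm x by rewrite subr_ge0 -enorm_le.
    exact: (scaled_bound (ltW eps_gt0) sxy (weight_gt0 p m0)
      (weight_le p_gt1 ux0 ux_m0) eps0).
  - move=> x t Ex ht; have ht' : 0 <= t < T by case/andP: ht => /ltW -> ->.
    set w := d / 2 * (rad ^+ 2 - sqnorm x).
    have w0 : 0 <= w by rewrite mulr_ge0 ?sq_rad// divr_ge0 ?ltW.
    apply: le_trans (squash_le p_gt1 w0 (barrier x t Ex ht')).
    have := squash_sub_ge p_gt1 (lexx 0) w0; rewrite squash0 !subr0.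
    apply: le_trans; rewrite ler_pdivlMr ?weight_gt0//.
    have wm1 : w <= m1.
      apply: ler_wpM2l; first by rewrite divr_ge0// ltW.
      by rewrite gerBl; exact: sqnorm_ge0.
    exact: (scaled_bound (ltW eps_gt0) (sq_rad x Ex) (weight_gt0 p m1)
      (weight_le p_gt1 w0 wm1) eps1).
move=> x0; split.
  apply: (blowup_point_eq0 p_gt1 rad_gt0 eps_gt0).
    by move=> x t Ex /andP[t0 tT]; apply: u_ge0; rewrite ?(ltW t0).
  move=> x t Ex /andP[t0 tT]; have := gap 0 x t.
  rewrite enorm0 enorm_ge0 (ltW t0) -(sqr_enorm 0) enorm0 expr0n subr0.
  by apply.
move=> ->; apply: (blowup_point0 rad_gt0 T_gt0 _ u_blows_up) => x t Ex ht.
by apply: mono => //; rewrite enorm0 enorm_ge0.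
Qed.
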